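(* Let $d>0$ be an integer, let $\mathcal{E}$ be an exact category with enough projectives $\mathcal{P}$, and let $\mathcal{M}$ be a full subcategory of $\mathcal{E}$. (i) $\mathcal{M}$ is a $d$-cluster tilting subcategory of the exact category $\mathcal{E}$ if and only if $\underline{\mathcal{M}}$ is a $d$-cluster tilting subcategory of the left triangulated category $\underline{\mathcal{E}}$. (ii) $\mathcal{M}$ is a $d\mathbb{Z}$-cluster tilting subcategory of the exact category $\mathcal{E}$ if and only if $\underline{\mathcal{M}}$ is a $d\mathbb{Z}$-cluster tilting subcategory of the left triangulated category $\underline{\mathcal{E}}$.
   Context: Exact categories are in the sense of Quillen (conventions of Bühler). $\mathcal{P}$ is the full subcategory of projective objects. Cluster tilting in an exact category: a full subcategory $\mathcal{M}\subseteq\mathcal{E}$ is $d$-cluster tilting if (1) it is functorially finite, i.e. for each $E\in\mathcal{E}$ there is a morphism $M\to E$ with $M\in\mathcal{M}$ such that $\operatorname{Hom}(M',M)\to\operatorname{Hom}(M',E)$ is surjective for all $M'\in\mathcal{M}$, and a morphism $E\to M$ with $M\in\mathcal{M}$ such that $\operatorname{Hom}(M,M')\to\operatorname{Hom}(E,M')$ is surjective for all $M'\in\mathcal{M}$; (2) $\mathcal{M}=\{E\mid \operatorname{Ext}^i_{\mathcal{E}}(E,\mathcal{M})=0,\ 1\le i\le d-1\}=\{E\mid \operatorname{Ext}^i_{\mathcal{E}}(\mathcal{M},E)=0,\ 1\le i\le d-1\}$; (3) every $E\in\mathcal{E}$ admits an admissible monomorphism $E\to M$ and an admissible epimorphism $M'\to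 E$ with $M,M'\in\mathcal{M}$. It is $d\mathbb{Z}$-cluster tilting if moreover $\operatorname{Ext}^i_{\mathcal{E}}(\mathcal{M},\mathcal{M})=0$ for $i\notin d\mathbb{Z}$. Stable category: $\underline{\mathcal{E}}=\mathcal{E}/\mathcal{P}$ has the same objects as $\mathcal{E}$ (written $\underline{E}$) and morphisms modulo those factoring through projectives. $\underline{\mathcal{M}}$ is the full subcategory of $\underline{\mathcal{E}}$ with objects $\underline{M}$, $M\in\mathcal{M}$. The syzygy functor $\Omega\colon\underline{\mathcal{E}}\to\underline{\mathcal{E}}$ sends $\underline{E}$ to $\underline{\operatorname{Ker}p_E}$ for a chosen admissible epimorphism $p_E\colon P_E\to E$ with $P_E$ projective (on morphisms: lift to the projectives and restrict to kernels). With $\Omega$, $\underline{\mathcal{E}}$ is a left triangulated category, whose triangles are the sequences $\Omega C\to A\to B\to C$ isomorphic to some $\Omega\underline{E_1}\xrightarrow{\underline{u}}\underline{E_3}\xrightarrow{\underline{v}}\underline{E_2}\xrightarrow{\underline{w}}\underline{E_1}$ arising from a commutative diagram with exact rows $0\to\Omega E_1\to P\to E_1\to 0$ ($P$ projective) and $0\to E_3\xrightarrow{v}E_2\xrightarrow{w}E_1\to 0$, with vertical maps from the first row to the second given by $u\colon\Omega E_1\to E_3$, some $P\to E_2$, and $1_{E_1}$. (Isomorphisms of such sequences are given by $(\Omega h,f,g,h)$ with $f,g,h$ isomorphisms making everything commute.) $(d+2)$-angles: in a left triangulated category $\mathcal{C}$, a sequence $\Omega^d(C_1)\xrightarrow{\alpha_{d+2}}C_{d+2}\xrightarrow{\alpha_{d+1}}C_{d+1}\to\cdots\to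 C_2\xrightarrow{\alpha_1}C_1$ is a $(d+2)$-angle if there are objects $K_1=C_1,K_2,\dots,K_d,K_{d+1}=C_{d+2}$ and triangles $\Omega K_i\xrightarrow{u_i}K_{i+1}\xrightarrow{v_i}C_{i+1}\xrightarrow{w_i}K_i$ for $1\le i\le d$ such that $\alpha_1=w_1$, $\alpha_{d+1}=v_d$, $\alpha_i=v_{i-1}w_i$ for $2\le i\le d$, and $\alpha_{d+2}$ is the composite $\Omega^dK_1\xrightarrow{\Omega^{d-1}(u_1)}\Omega^{d-1}K_2\to\cdots\to\Omega K_d\xrightarrow{u_d}K_{d+1}$. Cluster tilting in a left triangulated category $\mathcal{C}$: a full additive subcategory $\mathcal{X}\subseteq\mathcal{C}$ is $d$-cluster tilting if (1) $\mathcal{X}$ is closed under direct summands in $\mathcal{C}$ (if $C\oplus C'$ is isomorphic to an object of $\mathcal{X}$, then $C\in\mathcal{X}$; in particular $\mathcal{X}$ is closed under isomorphism in $\mathcal{C}$); (2) for every $C\in\mathcal{C}$ there are $(d+2)$-angles $0\to C\to X^1\to\cdots\to X^d\to 0$ and $0\to X_d\to\cdots\to X_1\to C\to 0$ with all $X_i,X^i\in\mathcal{X}$; (3) for $C\in\mathcal{C}$, $X\in\mathcal{X}$ and $1\le i\le d-1$ the map $\operatorname{Hom}_{\mathcal{C}}(\Omega^{i-1}(X),C)\to\operatorname{Hom}_{\mathcal{C}}(\Omega^i(X),\Omega(C))$, $f\mapsto\Omega(f)$, is an isomorphism; (4) $\operatorname{Hom}_{\mathcal{C}}(\Omega^i(X'),X)=0$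 for $X,X'\in\mathcal{X}$ and $1\le i\le d-1$. It is $d\mathbb{Z}$-cluster tilting if moreover $\Omega^d(\mathcal{X})\subseteq\mathcal{X}$. *)

(* Defs.v *)
From HB Require Import structures.
From mathcomp Require Import all_boot all_algebra boolp.
From Stdlib Require List.
From Stdlib Require Import Relation_Operators.

Set Implicit Arguments.
Unset Strict Implicit.
Unset Printing Implicit Defensive.

Import GRing.Theory.
Local Open Scope ring_scope.
Local Open Scope quotient_scope.

(* Composition is written in the usual order: [g \co f] is f followed by g. *)
Record addCat := AddCat {
  ob :> Type;
  hom : ob -> ob -> zmodType;
  idm : forall A, hom A A;
  comp : forall A B C, hom B C -> hom A B -> hom A C;
  compA : forall A B C D (h : hom C D) (g : hom B C) (f : hom A B),
    comp h (comp g f) = comp (comp h g) f;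
  comp1m : forall A B (f : hom A B), comp (idm B) f = f;
  compm1 : forall A B (f : hom A B), comp f (idm A) = f;
  compDl : forall A B C (g g' : hom B C) (f : hom A B),
    comp (g + g') f = comp g f + comp g' f;
  compDr : forall A B C (g : hom B C) (f f' : hom A B),
    comp g (f + f') = comp g f + comp g f';
  zob : ob;
  zobP : idm zob = 0;
  bip : ob -> ob -> ob;
  bin1 : forall A B, hom A (bip A B);
  bin2 : forall A B, hom B (bip A B);
  bpr1 : forall A B, hom (bip A B) A;
  bpr2 : forall A B, hom (bip A B) B;
  bpr1_in1 : forall A B, comp (bpr1 A B) (bin1 A B) = idm A;
  bpr2_in2 : forall A B, comp (bpr2 A B) (bin2 A B) = idm B;
  bpr1_in2 : forall A B, comp (bpr1 A B) (bin2 A B) = 0;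
  bpr2_in1 : forall A B, comp (bpr2 A B) (bin1 A B) = 0;
  bip_sum : forall A B,
    comp (bin1 A B) (bpr1 A B) + comp (bin2 A B) (bpr2 A B) = idm (bip A B)
}.

Arguments hom {a} A B.
Arguments idm {a} A.
Arguments comp {a A B C} g f.
Arguments bip {a} A B.
Arguments zob {a}.
Arguments bin1 {a} A B.
Arguments bin2 {a} A B.
Arguments bpr1 {a} A B.
Arguments bpr2 {a} A B.

Notation "g \co f" := (comp g f) (at level 40, left associativity).

Section AddCatTheory.
Variable C : addCat.
Implicit Types X Y Z : C.

Lemma compm0 X Y Z (g : hom Y Z) : g \co (0 : hom X Y) = 0.
Proof. by apply: (addIr (g \co 0)); rewrite -compDr !add0r. Qed.

Lemma comp0m X Y Z (f : hom X Y) : (0 : hom Y Z) \co f = 0.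
Proof. by apply: (addIr (0 \co f)); rewrite -compDl !add0r. Qed.

Lemma compmN X Y Z (g : hom Y Z) (f : hom X Y) : g \co (- f) = - (g \co f).
Proof. by apply: (addIr (g \co f)); rewrite -compDr !addNr compm0. Qed.

Lemma compNm X Y Z (g : hom Y Z) (f : hom X Y) : (- g) \co f = - (g \co f).
Proof. by apply: (addIr (g \co f)); rewrite -compDl !addNr comp0m. Qed.

Lemma compBr X Y Z (g : hom Y Z) (f f' : hom X Y) :
  g \co (f - f') = g \co f - g \co f'.
Proof. by rewrite compDr compmN. Qed.

Lemma compBl X Y Z (g g' : hom Y Z) (f : hom X Y) :
  (g - g') \co f = g \co f - g' \co f.
Proof. by rewrite compDl compNm. Qed.

Definition is_iso X Y (f : hom X Y) :=
  exists g : hom Y X, g \co f = idm X /\ f \co g = idm Y.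

Definition is_kernel X Y Z (i : hom X Y) (p : hom Y Z) :=
  p \co i = 0 /\
  forall W (x : hom W Y), p \co x = 0 -> exists! y : hom W X, i \co y = x.

Definition is_cokernel X Y Z (i : hom X Y) (p : hom Y Z) :=
  p \co i = 0 /\
  forall W (x : hom Y W), x \co i = 0 -> exists! y : hom Z W, y \co p = x.

(* The square  f' \co i = i' \co f  is a pushout, for  i : A -> B, f : A -> A',
   i' : A' -> B', f' : B -> B'. *)
Definition is_pushout A B A' B' (i : @hom C A B) (f : @hom C A A')
    (i' : @hom C A' B') (f' : @hom C B B') :=
  f' \co i = i' \co f /\
  forall W (x : hom B W) (y : hom A' W), x \co i = y \co f ->
    exists! z : hom B' W, z \co f' = x /\ z \co i' = y.

(* The square  p \co f' = f \co p'  is a pullback, for  p : B -> A, f : A' -> A,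
   p' : B' -> A', f' : B' -> B. *)
Definition is_pullback A B A' B' (p : @hom C B A) (f : @hom C A' A)
    (p' : @hom C B' A') (f' : @hom C B' B) :=
  p \co f' = f \co p' /\
  forall W (x : hom W B) (y : hom W A'), p \co x = f \co y ->
    exists! z : hom W B', f' \co z = x /\ p' \co z = y.

End AddCatTheory.

Definition adm_mono_for (C : addCat)
    (confl : forall A B D : C, hom A B -> hom B D -> Prop)
    (A B : C) (i : hom A B) := exists (D : C) (p : hom B D), confl A B D i p.

Definition adm_epi_for (C : addCat)
    (confl : forall A B D : C, hom A B -> hom B D -> Prop)
    (B D : C) (p : hom B D) := exists (A : C) (i : hom A B), confl A B D i p.

(* Quillen's axioms in Bühler's formulation. [confl i p] says that (i, p) is one
   of the distinguished kernel-cokernel pairs, i.e. that  0 -> A -> B -> D -> 0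
   is an (admissible) exact sequence. *)
Record exactCat := ExactCat {
  ecat :> addCat;
  confl : forall A B D : ecat, hom A B -> hom B D -> Prop;
  confl_ker : forall A B D (i : hom A B) (p : hom B D),
    confl i p -> is_kernel i p;
  confl_coker : forall A B D (i : hom A B) (p : hom B D),
    confl i p -> is_cokernel i p;
  confl_iso : forall A B D A' B' D' (i : hom A B) (p : hom B D)
      (i' : hom A' B') (p' : hom B' D')
      (a : hom A A') (b : hom B B') (c : hom D D'),
    is_iso a -> is_iso b -> is_iso c ->
    i' \co a = b \co i -> p' \co b = c \co p -> confl i p -> confl i' p';
  adm_mono_id : forall A, adm_mono_for confl (idm A);
  adm_epi_id : forall A, adm_epi_for confl (idm A);
  adm_mono_comp : forall A B D (i : hom A B) (j : hom B D),
    adm_mono_for confl i -> adm_mono_for confl j ->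
    adm_mono_for confl (j \co i);
  adm_epi_comp : forall A B D (p : hom A B) (q : hom B D),
    adm_epi_for confl p -> adm_epi_for confl q ->
    adm_epi_for confl (q \co p);
  adm_mono_pushout : forall A B A' (i : hom A B) (f : hom A A'),
    adm_mono_for confl i ->
    exists B' (i' : hom A' B') (f' : hom B B'),
      is_pushout i f i' f' /\ adm_mono_for confl i';
  adm_epi_pullback : forall A B A' (p : hom B A) (f : hom A' A),
    adm_epi_for confl p ->
    exists B' (p' : hom B' A') (f' : hom B' B),
      is_pullback p f p' f' /\ adm_epi_for confl p'
}.

Section Exact.
Variable E : exactCat.
Implicit Types A B X P : E.

Definition adm_mono A B (i : hom A B) := adm_mono_for (@confl E) i.
Definition adm_epi A B (p : hom A B) := adm_epi_for (@confl E) p.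

Definition projective P := forall A B (p : hom A B) (f : hom P B),
  adm_epi p -> exists g : hom P A, p \co g = f.

Definition enough_projectives :=
  forall A, exists P (p : hom P A), projective P /\ adm_epi p.

Record ses B A := Ses {
  mid : E;
  sinc : hom B mid;
  sprj : hom mid A;
  sesP : confl sinc sprj
}.

(* [yext n A B] is the type of exact sequences
     0 -> B -> X_n -> ... -> X_0 -> A -> 0
   with n + 1 middle terms, given as a splice of the short exact sequences
   K -> X_0 -> A  and (recursively)  0 -> B -> X_n -> ... -> X_1 -> K -> 0. *)
Fixpoint yext (n : nat) (A B : E) : Type :=
  if n is m.+1 then {K : E & (ses K A * yext m K B)%type} else ses B A.

Definition ses_mor B A B' A' (b : hom B B') (a : hom A A')
    (s : ses B A) (s' : ses B' A') :=
  exists m : hom (mid s) (mid s'),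
    sinc s' \co b = m \co sinc s /\ sprj s' \co m = a \co sprj s.

Fixpoint yext_mor (n : nat) (A A' B B' : E) (a : hom A A') (b : hom B B') :
    yext n A B -> yext n A' B' -> Prop :=
  if n is m.+1 then fun x x' =>
    exists k : hom (projT1 x) (projT1 x'),
      ses_mor k a (projT2 x).1 (projT2 x').1 /\
      yext_mor k b (projT2 x).2 (projT2 x').2
  else fun x x' => ses_mor b a x x'.

Definition yext_equiv n A B : yext n A B -> yext n A B -> Prop :=
  clos_refl_sym_trans _ (yext_mor (idm A) (idm B)).

(* Ext^0 is Hom. For i > 0, Ext^i(A, B) is the set of Yoneda equivalence classes
   of exact sequences with i middle terms; it always contains the class of the
   zero element, so it is zero iff any two such sequences are equivalent. *)
Definition Ext_eq0 (i : nat) A B : Prop :=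
  if i is n.+1 then forall x y : yext n A B, yext_equiv x y
  else forall f : hom A B, f = 0.

(* Full subcategories of E are given by predicates on objects. *)

Definition functorially_finite (M : E -> Prop) :=
  forall A,
    (exists X (f : hom X A), M X /\
       forall X', M X' -> forall g : hom X' A, exists h : hom X' X, f \co h = g)
    /\
    (exists X (f : hom A X), M X /\
       forall X', M X' -> forall g : hom A X', exists h : hom X X', h \co f = g).

Definition exact_dCT (d : nat) (M : E -> Prop) :=
  [/\ functorially_finite M,
      forall A, M A <->
        (forall X i, M X -> (1 <= i <= d - 1)%N -> Ext_eq0 i A X),
      forall A, M A <->
        (forall X i, M X -> (1 <= i <= d - 1)%N -> Ext_eq0 i X A) &
      forall A,
        (exists X (i : hom A X), M X /\ adm_mono i) /\
        (exists X (p : hom X A), M X /\ adm_epi p)].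

Definition exact_dZCT (d : nat) (M : E -> Prop) :=
  exact_dCT d M /\
  forall i, ~~ (d %| i)%N -> forall X Y, M X -> M Y -> Ext_eq0 i X Y.

End Exact.

(* The data of a left triangulated category: an additive category with an
   additive endofunctor Omega and a class of triangles
     Omega C --h--> A --f--> B --g--> C.
   The axioms on triangles play no role in the definitions below. *)
Record ltriCat := LtriCat {
  lcat :> addCat;
  Om : lcat -> lcat;
  Om1 : forall A B : lcat, hom A B -> hom (Om A) (Om B);
  Om1_id : forall A, Om1 (idm A) = idm (Om A);
  Om1_comp : forall A B D (g : hom B D) (f : hom A B),
    Om1 (g \co f) = Om1 g \co Om1 f;
  Om1_add : forall A B (f g : hom A B), Om1 (f + g) = Om1 f + Om1 g;
  tri : forall A B D : lcat,
    hom (Om D) A -> hom A B -> hom B D -> Prop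
}.

Arguments Om {l} A.
Arguments Om1 {l A B} f.
Arguments tri {l A B D} h f g.

Section LeftTriangulated.
Variable T : ltriCat.
Implicit Types A B C K X : T.

Definition OmN (n : nat) A : T := iter n (@Om T) A.

(* Strings of n.+1 composable morphisms
     A = A_{n+1} -> A_n -> ... -> A_1 -> A_0 = B. *)
Fixpoint string (n : nat) (A B : T) : Type :=
  if n is m.+1 then {C : T & (hom A C * string m C B)%type} else hom A B.

(* Replaces the first morphism  v : K -> A_n  of a string by  v \co w. *)
Definition precomp n A K B (w : hom A K) : string n K B -> string n A B :=
  match n return string n K B -> string n A B with
  | 0 => fun f => f \co w
  | m.+1 => fun s => existT _ (projT1 s) ((projT2 s).1 \co w, (projT2 s).2)
  end.

(* The objects A_n, ..., A_1, excluding both ends. *)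
Fixpoint inner n A B : string n A B -> seq T :=
  match n return string n A B -> seq T with
  | 0 => fun _ => [::]
  | m.+1 => fun s => projT1 s :: inner (projT2 s).2
  end.

(* [angle d h s]: the sequence formed by h = alpha_{d+2} : Omega^d C1 -> A and
   by the string  s = (alpha_{d+1}, ..., alpha_1)  from A = C_{d+2} to C1 is a
   (d+2)-angle. The recursion adds the last triangle
     Omega K_{d+1} --u--> K_{d+2} --v--> C_{d+2} --w--> K_{d+1}
   to a (d+2)-angle with C_{d+2} = K_{d+1}: the morphism alpha_{d+1} = v_d, which
   starts at K_{d+1}, becomes  v_d \co w,  the new first morphism is v, and the
   composite  u_d \co ... \co Omega^{d-1} u_1  becomes
   u \co Omega (u_d \co ... \co Omega^{d-1} u_1). *)
Inductive angle : forall d C1 A,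
    hom (OmN d C1) A -> string d A C1 -> Prop :=
| angle1 C1 K B (u : hom (OmN 1 C1) K) (v : hom K B) (w : hom B C1) :
    tri u v w -> @angle 1 C1 K u (existT _ B (v, w))
| angleS d C1 K A B (h : hom (OmN d C1) K) (s : string d K C1)
    (u : hom (Om K) A) (v : hom A B) (w : hom B K) :
    angle h s -> tri u v w ->
    @angle d.+1 C1 A (u \co Om1 h) (existT _ B (v, precomp w s)).

(* There is a (d+2)-angle  0 -> C -> X^1 -> ... -> X^d -> 0  with all X^i in X.
   Here and below, the final 0 is C_1 and the initial 0 is Omega^d(0). *)
Definition coresolving_angle d (X : T -> Prop) C :=
  exists (h : hom (OmN d zob) C) (s : string d C zob),
    angle h s /\ List.Forall X (inner s).

(* There is a (d+2)-angle  0 -> X_d -> ... -> X_1 -> C -> 0  with all X_i in X: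
   its objects C_{d+2}, ..., C_2 are X_d, ..., X_1, C. *)
Definition resolving_angle d (X : T -> Prop) C :=
  exists (A : T) (h : hom (OmN d zob) A) (s : string d A zob) (Xs : seq T),
    [/\ angle h s, A :: inner s = rcons Xs C & List.Forall X Xs].

Definition additive_subcat (X : T -> Prop) :=
  X zob /\ forall A B, X A -> X B -> X (bip A B).

Definition summand_closed (X : T -> Prop) :=
  forall A C C', X A -> (exists f : hom (bip C C') A, is_iso f) -> X C.

Definition ltri_dCT (d : nat) (X : T -> Prop) :=
  [/\ additive_subcat X,
      summand_closed X,
      forall C, coresolving_angle d X C /\ resolving_angle d X C,
      forall C A i, X A -> (1 <= i <= d - 1)%N ->
        bijective (fun f : hom (OmN i.-1 A) C => Om1 f) &
      forall A A' i, X A -> X A' -> (1 <= i <= d - 1)%N ->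
        forall f : hom (OmN i A') A, f = 0].

Definition ltri_dZCT (d : nat) (X : T -> Prop) :=
  ltri_dCT d X /\ forall A, X A -> X (OmN d A).

End LeftTriangulated.

Section Ideal.
Variables (E : exactCat) (A B : E).

Definition proj_factor : pred (hom A B) := fun f =>
  `[< exists P (h : hom P B) (g : hom A P), projective P /\ f = h \co g >].

Lemma projective_zob : projective (zob : E).
Proof.
move=> X Y p f _; exists 0; rewrite compm0.
by rewrite -[f]compm1 zobP compm0.
Qed.

Lemma projective_bip (P Q : E) :
  projective P -> projective Q -> projective (bip P Q).
Proof.
move=> hP hQ X Y p f pepi.
have [g1 e1] := hP _ _ p (f \co bin1 P Q) pepi.
have [g2 e2] := hQ _ _ p (f \co bin2 P Q) pepi.
exists (g1 \co bpr1 P Q + g2 \co bpr2 P Q).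
by rewrite compDr !compA e1 e2 -!compA -compDr bip_sum compm1.
Qed.

Lemma proj_factor_zmod_closed : zmod_closed proj_factor.
Proof.
split.
  apply/asboolP; exists zob, 0, 0; split; first exact: projective_zob.
  by rewrite compm0.
move=> _ _ /asboolP[P [h [g [hP ->]]]] /asboolP[Q [k [l [hQ ->]]]].
apply/asboolP; exists (bip P Q), (h \co bpr1 P Q - k \co bpr2 P Q).
exists (bin1 P Q \co g + bin2 P Q \co l); split; first exact: projective_bip.
rewrite compBl !compDr -!compA.
rewrite (compA (bpr1 P Q) (bin1 P Q)) (compA (bpr1 P Q) (bin2 P Q)).
rewrite (compA (bpr2 P Q) (bin1 P Q)) (compA (bpr2 P Q) (bin2 P Q)).
rewrite bpr1_in1 bpr2_in2 bpr1_in2 bpr2_in1 !comp1m !comp0m !compm0.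
by rewrite addr0 add0r.
Qed.

HB.instance Definition _ :=
  GRing.isZmodClosed.Build (hom A B) proj_factor proj_factor_zmod_closed.

Definition proj_ideal : zmodClosed (hom A B) :=
  GRing.ZmodClosed.clone (hom A B) proj_factor _.

Definition shom : zmodType := Quotient.quot proj_ideal.

Definition cl (f : hom A B) : shom := \pi_(Quotient.quot proj_ideal) f.

Lemma cl_eq (f g : hom A B) : cl f = cl g <->
  exists P (h : hom P B) (k : hom A P), projective P /\ f - g = h \co k.
Proof.
rewrite /cl; split.
  by move/eqP; rewrite -Quotient.idealrBE => /asboolP.
by move=> H; apply/eqP; rewrite -Quotient.idealrBE; apply/asboolP.
Qed.

Lemma cl_repr (f : shom) : cl (repr f) = f.
Proof. by rewrite /cl reprK. Qed.

Lemma cl_add (f g : hom A B) : cl (f + g) = cl f + cl g.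
Proof. by rewrite /cl raddfD. Qed.

Lemma cl_zero : cl 0 = 0.
Proof. by rewrite /cl raddf0. Qed.

End Ideal.

Section StableCategory.
Variable E : exactCat.
Implicit Types A B D : E.

Definition scomp A B D (g : shom B D) (f : shom A B) : shom A D :=
  cl (repr g \co repr f).

Lemma scomp_cl A B D (g : hom B D) (f : hom A B) :
  scomp (cl g) (cl f) = cl (g \co f).
Proof.
have /cl_eq[P [h [k [hP e]]]] := cl_repr (cl g).
have /cl_eq[Q [h' [k' [hQ e']]]] := cl_repr (cl f).
apply/esym/eqP; rewrite eq_sym /scomp; apply/eqP.
transitivity (cl (g \co repr (cl f))); apply/cl_eq.
  exists P, h, (k \co repr (cl f)); split=> //.
  by rewrite -compBl e compA.
exists Q, (g \co h'), k'; split=> //.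
by rewrite -compBr e' compA.
Qed.

Lemma scompA A B C D (h : shom C D) (g : shom B C) (f : shom A B) :
  scomp h (scomp g f) = scomp (scomp h g) f.
Proof.
by rewrite -(cl_repr h) -(cl_repr g) -(cl_repr f) !scomp_cl compA.
Qed.

Lemma scomp1m A B (f : shom A B) : scomp (cl (idm B)) f = f.
Proof. by rewrite -(cl_repr f) scomp_cl comp1m. Qed.

Lemma scompm1 A B (f : shom A B) : scomp f (cl (idm A)) = f.
Proof. by rewrite -(cl_repr f) scomp_cl compm1. Qed.

Lemma scompDl A B D (g g' : shom B D) (f : shom A B) :
  scomp (g + g') f = scomp g f + scomp g' f.
Proof.
rewrite -(cl_repr g) -(cl_repr g') -(cl_repr f) -cl_add !scomp_cl.
by rewrite compDl cl_add.
Qed.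

Lemma scompDr A B D (g : shom B D) (f f' : shom A B) :
  scomp g (f + f') = scomp g f + scomp g f'.
Proof.
rewrite -(cl_repr g) -(cl_repr f) -(cl_repr f') -cl_add !scomp_cl.
by rewrite compDr cl_add.
Qed.

Lemma szobP : cl (idm (zob : E)) = 0.
Proof. by rewrite zobP cl_zero. Qed.

Lemma sbpr1_in1 A B : scomp (cl (bpr1 A B)) (cl (bin1 A B)) = cl (idm A).
Proof. by rewrite scomp_cl bpr1_in1. Qed.

Lemma sbpr2_in2 A B : scomp (cl (bpr2 A B)) (cl (bin2 A B)) = cl (idm B).
Proof. by rewrite scomp_cl bpr2_in2. Qed.

Lemma sbpr1_in2 A B : scomp (cl (bpr1 A B)) (cl (bin2 A B)) = 0.
Proof. by rewrite scomp_cl bpr1_in2 cl_zero. Qed.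

Lemma sbpr2_in1 A B : scomp (cl (bpr2 A B)) (cl (bin1 A B)) = 0.
Proof. by rewrite scomp_cl bpr2_in1 cl_zero. Qed.

Lemma sbip_sum A B :
  scomp (cl (bin1 A B)) (cl (bpr1 A B)) + scomp (cl (bin2 A B)) (cl (bpr2 A B))
  = cl (idm (bip A B)).
Proof. by rewrite !scomp_cl -cl_add bip_sum. Qed.

Definition stable : addCat :=
  AddCat scompA scomp1m scompm1 scompDl scompDr szobP
    sbpr1_in1 sbpr2_in2 sbpr1_in2 sbpr2_in1 sbip_sum.

(* The full subcategory of the stable category on the objects of M. *)
Definition stable_sub (M : E -> Prop) : stable -> Prop := M.

End StableCategory.

Record syzygies (E : exactCat) := Syzygies {
  pcov : E -> E;
  pcov_proj : forall A, projective (pcov A);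
  syz : E -> E;
  syz_inc : forall A, hom (syz A) (pcov A);
  pcov_epi : forall A, hom (pcov A) A;
  syz_confl : forall A, confl (syz_inc A) (pcov_epi A)
}.

Section Syzygy.
Variables (E : exactCat) (S : syzygies E).
Implicit Types A B C D : E.

Local Notation P := (pcov S).
Local Notation O := (syz S).
Local Notation inc := (syz_inc S).
Local Notation epi := (pcov_epi S).

(* k : Omega A -> Omega B is obtained from f : A -> B by lifting to the chosen
   projectives and restricting to the kernels. *)
Definition syz_lift A B (f : hom A B) (k : hom (O A) (O B)) :=
  exists l : hom (P A) (P B),
    epi B \co l = f \co epi A /\ inc B \co k = l \co inc A.

Lemma pcov_adm A : adm_epi (epi A).
Proof. by exists (O A), (inc A); exact: syz_confl. Qed.

Lemma syz_kerP A X (x : hom X (P A)) :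
  epi A \co x = 0 -> exists y : hom X (O A), inc A \co y = x.
Proof.
by move=> e; have [_ /(_ X x e)[y [ey _]]] := confl_ker (syz_confl S A); exists y.
Qed.

Lemma syz_inc_inj A X (y y' : hom X (O A)) :
  inc A \co y = inc A \co y' -> y = y'.
Proof.
have [e0 ker] := confl_ker (syz_confl S A) => e.
have e1 : epi A \co (inc A \co y') = 0 by rewrite compA e0 comp0m.
by have [z [_ uz]] := ker X _ e1; rewrite -(uz y e) -(uz y').
Qed.

Lemma epi_inc A : epi A \co inc A = 0.
Proof. by have [] := confl_ker (syz_confl S A). Qed.

Lemma syz_lift_ex A B (f : hom A B) : exists k, syz_lift f k.
Proof.
have [l el] := pcov_proj (f \co epi A) (pcov_adm B).
have e0 : epi B \co (l \co inc A) = 0.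
  by rewrite compA el -compA epi_inc compm0.
by have [k ek] := syz_kerP e0; exists k, l.
Qed.

Lemma syz_lift_uniq A B (f f' : hom A B) k k' :
  syz_lift f k -> syz_lift f' k' -> cl f = cl f' -> cl k = cl k'.
Proof.
move=> [l [el ek]] [l' [el' ek']] /cl_eq[Q [h [g [hQ e]]]].
have [s es] := hQ _ _ (epi B) h (pcov_adm B).
have e0 : epi B \co (l - l' - s \co g \co epi A) = 0.
  by rewrite !compBr el el' !compA es -e compBl subrr.
have [t et] := syz_kerP e0.
apply/cl_eq; exists (P A), t, (inc A); split; first exact: pcov_proj.
apply: syz_inc_inj.
by rewrite compA et !compBl -[_ \co epi A \co _]compA epi_inc compm0 subr0
  compBr ek ek'.
Qed.

Definition syz_map A B (f : hom A B) : hom (O A) (O B) :=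
  sval (cid (syz_lift_ex f)).

Lemma syz_mapP A B (f : hom A B) : syz_lift f (syz_map f).
Proof. exact: svalP (cid (syz_lift_ex f)). Qed.

Definition sOm1 A B (f : @hom (stable E) A B) : @hom (stable E) (O A) (O B) :=
  cl (syz_map (repr (f : shom A B))).

Lemma sOm1_cl A B (f : hom A B) k : syz_lift f k -> sOm1 (cl f) = cl k.
Proof.
by move=> fk; apply: (syz_lift_uniq (syz_mapP _) fk); rewrite cl_repr.
Qed.

Lemma sOm1_id A : sOm1 (idm (A : stable E)) = idm (O A : stable E).
Proof.
apply: (@sOm1_cl A A (idm A) (idm (O A))).
by exists (idm _); rewrite !compm1 !comp1m.
Qed.

Lemma sOm1_comp A B D (g : @hom (stable E) B D) (f : @hom (stable E) A B) :
  sOm1 (g \co f) = sOm1 g \co sOm1 f.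
Proof.
rewrite -[g](@cl_repr E B D) -[f](@cl_repr E A B).
move: (repr f) (repr g) => {}f {}g.
have [l [el ek]] := syz_mapP f; have [m [em en]] := syz_mapP g.
have gf : syz_lift (g \co f) (syz_map g \co syz_map f).
  exists (m \co l); split; first by rewrite compA em -compA el compA.
  by rewrite compA en -compA ek compA.
rewrite (sOm1_cl (syz_mapP f)) (sOm1_cl (syz_mapP g)) /= !scomp_cl.
exact: sOm1_cl.
Qed.

Lemma sOm1_add A B (f g : @hom (stable E) A B) : sOm1 (f + g) = sOm1 f + sOm1 g.
Proof.
rewrite -[f](@cl_repr E A B) -[g](@cl_repr E A B).
move: (repr f) (repr g) => {}f {}g.
have [l [el ek]] := syz_mapP f; have [m [em en]] := syz_mapP g.
have fg : syz_lift (f + g) (syz_map f + syz_map g).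
  by exists (l + m); rewrite !compDr !compDl el em ek en.
by rewrite (sOm1_cl (syz_mapP f)) (sOm1_cl (syz_mapP g)) -!cl_add (sOm1_cl fg).
Qed.

(* The sequence (h, f, g) is isomorphic, through (Omega c, a, b, c), to the one
   given by the classes of u, v, w, where u comes from a morphism (u, m, 1) of
   the chosen sequence  Omega E1 -> P E1 -> E1  to  E3 -> E2 -> E1. *)
Definition stri (A B C : stable E)
    (h : @hom (stable E) (O C) A) (f : hom A B) (g : hom B C) : Prop :=
  exists (E1 E2 E3 : E) (v : hom E3 E2) (w : hom E2 E1)
      (u : hom (O E1) E3) (m : hom (P E1) E2)
      (a : @hom (stable E) A E3) (b : @hom (stable E) B E2)
      (c : @hom (stable E) C E1),
    [/\ confl v w,
        m \co inc E1 = v \co u /\ w \co m = epi E1,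
        [/\ is_iso a, is_iso b & is_iso c] &
        [/\ a \co h = (cl u : @hom (stable E) _ _) \co sOm1 c,
            b \co f = (cl v : @hom (stable E) _ _) \co a &
            c \co g = (cl w : @hom (stable E) _ _) \co b]].

Definition stable_ltri : ltriCat :=
  @LtriCat (stable E) (syz S) sOm1 sOm1_id sOm1_comp sOm1_add stri.

End Syzygy.

(* Main.v *)
From mathcomp Require Import all_boot ssralg boolp.
From Stdlib Require List.
From Stdlib Require Import Relation_Operators.
Require Import Defs.

(** Write [O] for the syzygy and [P] for the chosen projective cover.  The bridge
    between the two sides is a description of Ext by stable morphisms.  Comparing
    an exact sequence with the projective resolution shows that [Ext^(n+1)(A, B)]
    vanishes if and only if every morphism [O^(n+1) A -> B] extends along
    [O^(n+1) A -> P (O^n A)] ([Ext_eq0_ext0]).  If [Ext^(n+1)(A, Q) = 0] for all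
    projective [Q], this means that every such morphism is zero in the stable
    category ([ext0_thru_proj]).  Moreover [Ext^1(B, Q) = 0] for all projective
    [Q] if and only if [Omega : Hom(B, C) -> Hom(O B, O C)] is bijective for all
    [C] ([ext_proj0_Om1_bij], [Om1_bij_ext_proj0]).  Hence the bijectivity and the
    vanishing conditions in the definition of a stable [d]-cluster tilting
    subcategory say together that [M] and the projectives receive no extensions
    from [M] in degrees [1, ..., d - 1].

    It remains to translate between approximations and angles.  An angle is a
    chain of triangles, hence of conflations up to stable isomorphism.  If [M] is
    cluster tilting in the exact category, [d - 1] successive left approximations
    by [M] that are inflations give a coresolving chain: by the long exact sequence
    the [j]-th cokernel has no extensions into [M] in degrees [1, ..., j], so that
    the last one lies in [M] ([exactCT_coresolution]).  Right approximations that
    are deflations give a resolving chain ([exactCT_resolution]).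

    Conversely, let [A] have no extensions into [M] in degrees [1, ..., d - 1].
    Shifting dimensions along a resolving chain of [C] produces a conflation
    [X -> Y -> Z] with [Y] in [M], [Z] stably isomorphic to [C] and
    [Ext^1(A, X) = 0] ([stableCT_resolving_confl]).  For [C = A] it splits, which
    puts [A] in [M]; for [A] in [M] and general [C] it gives a right approximation
    of [C].  Coresolving chains yield the dual statements
    ([stableCT_coresolving_confl]).

    The [dZ] refinement is the equality of [Ext^(i+d)(A, -)] with
    [Ext^i(O^d A, -)]. *)

Set Implicit Arguments.
Unset Strict Implicit.
Unset Printing Implicit Defensive.

Import GRing.Theory.
Local Open Scope ring_scope.

(** * Additive categories *)

Section Additive.
Variable C : addCat.
Implicit Types A B D W X Y Z : C.

Definition mpair W A B (f : hom W A) (g : hom W B) : hom W (bip A B) :=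
  bin1 A B \co f + bin2 A B \co g.

Definition copair A B W (f : hom A W) (g : hom B W) : hom (bip A B) W :=
  f \co bpr1 A B + g \co bpr2 A B.

Lemma bpr1_pair W A B (f : hom W A) (g : hom W B) : bpr1 A B \co mpair f g = f.
Proof.
by rewrite compDr !compA bpr1_in1 bpr1_in2 comp1m comp0m addr0.
Qed.

Lemma bpr2_pair W A B (f : hom W A) (g : hom W B) : bpr2 A B \co mpair f g = g.
Proof.
by rewrite compDr !compA bpr2_in1 bpr2_in2 comp1m comp0m add0r.
Qed.

Lemma copair_bin1 A B W (f : hom A W) (g : hom B W) : copair f g \co bin1 A B = f.
Proof.
by rewrite compDl -!compA bpr1_in1 bpr2_in1 compm1 compm0 addr0.
Qed.

Lemma copair_bin2 A B W (f : hom A W) (g : hom B W) : copair f g \co bin2 A B = g.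
Proof.
by rewrite compDl -!compA bpr1_in2 bpr2_in2 compm1 compm0 add0r.
Qed.

Lemma copair_pair W A B Z (f : hom A Z) (g : hom B Z) (f' : hom W A) (g' : hom W B) :
  copair f g \co mpair f' g' = f \co f' + g \co g'.
Proof. by rewrite compDl -!compA bpr1_pair bpr2_pair. Qed.

Lemma bip_hom_ext W A B (x y : hom W (bip A B)) :
  bpr1 A B \co x = bpr1 A B \co y -> bpr2 A B \co x = bpr2 A B \co y -> x = y.
Proof.
move=> e1 e2; rewrite -[x]comp1m -[y]comp1m -bip_sum !compDl -!compA.
by rewrite e1 e2.
Qed.

Lemma bip_cohom_ext W A B (x y : hom (bip A B) W) :
  x \co bin1 A B = y \co bin1 A B -> x \co bin2 A B = y \co bin2 A B -> x = y.
Proof.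
move=> e1 e2; rewrite -[x]compm1 -[y]compm1 -bip_sum !compDr !compA.
by rewrite e1 e2.
Qed.

Lemma hom_from_zob A (f : hom zob A) : f = 0.
Proof. by rewrite -[f]compm1 zobP compm0. Qed.

Lemma hom_to_zob A (f : hom A zob) : f = 0.
Proof. by rewrite -[f]comp1m zobP comp0m. Qed.

Lemma is_iso_idm A : is_iso (idm A).
Proof. by exists (idm A); rewrite comp1m. Qed.

Lemma kernel_mono X Y Z (i : hom X Y) (p : hom Y Z) W (x y : hom W X) :
  is_kernel i p -> i \co x = i \co y -> x = y.
Proof.
move=> [e0 ker] e.
have [|z [_ uz]] := ker W (i \co x); first by rewrite compA e0 comp0m.
by rewrite -(uz x) // -(uz y).
Qed.

Lemma cokernel_epi X Y Z (i : hom X Y) (p : hom Y Z) W (x y : hom Z W) :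
  is_cokernel i p -> x \co p = y \co p -> x = y.
Proof.
move=> [e0 ker] e.
have [|z [_ uz]] := ker W (x \co p); first by rewrite -compA e0 compm0.
by rewrite -(uz x) // -(uz y).
Qed.

Lemma pushout_hom_ext A B A' B' (i : @hom C A B) (f : @hom C A A')
    (i' : @hom C A' B') (f' : @hom C B B') W (x y : hom B' W) :
  is_pushout i f i' f' -> x \co f' = y \co f' -> x \co i' = y \co i' -> x = y.
Proof.
move=> [sq univ] ef ei.
have [|z [_ uz]] := univ W (x \co f') (x \co i'); first by rewrite -!compA sq.
by rewrite -(uz x) // -(uz y).
Qed.

(** Dualizing turns statements on pushouts and inflations into statements on
    pullbacks and deflations. *)
Definition op_cat : addCat.
Proof.
refine (@AddCat (ob C) (fun A B => hom B A) (fun A => idm A)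
  (fun A B D g f => f \co g) _ _ _ _ _ zob (zobP C) (@bip C)
  (@bpr1 C) (@bpr2 C) (@bin1 C) (@bin2 C) _ _ _ _ _) => /=.
- by move=> *; rewrite compA.
- by move=> *; rewrite compm1.
- by move=> *; rewrite comp1m.
- by move=> *; rewrite compDr.
- by move=> *; rewrite compDl.
- by move=> *; rewrite bpr1_in1.
- by move=> *; rewrite bpr2_in2.
- by move=> *; rewrite bpr2_in1.
- by move=> *; rewrite bpr1_in2.
- by move=> *; rewrite bip_sum.
Defined.

End Additive.

(** * Exact categories *)

Definition op_exact (E : exactCat) : exactCat.
Proof.
refine (@ExactCat (op_cat E) (fun A B D i p => @confl E D B A p i)
  _ _ _ _ _ _ _ _ _) => /=.
- by move=> A B D i p /confl_coker.
- by move=> A B D i p /confl_ker.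
- move=> A B D A' B' D' i p i' p' a b c [a' [a1 a2]] [b' [b1 b2]] [c' [c1 c2]] e1 e2.
  rewrite /= in a1 a2 b1 b2 c1 c2 e1 e2.
  apply: (@confl_iso E _ _ _ _ _ _ _ _ _ _ c' b' a').
  + by exists c.
  + by exists b.
  + by exists a.
  + by rewrite -[RHS]compm1 -c1 -compA (compA p) -e2 !compA b2 comp1m.
  + by rewrite -[LHS]comp1m -a2 -!compA (compA a) e1 -compA b1 compm1.
- move=> A; have [D [p c]] := adm_epi_id A; by exists D, p.
- move=> A; have [D [p c]] := adm_mono_id A; by exists D, p.
- by move=> A B D i j hi hj; exact: (@adm_epi_comp E _ _ _ j i).
- by move=> A B D i j hi hj; exact: (@adm_mono_comp E _ _ _ j i).
- by move=> A B A' i f hi; exact: (@adm_epi_pullback E).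
- by move=> A B A' i f hi; exact: (@adm_mono_pushout E).
Defined.

Section Conflations.
Variable E : exactCat.
Implicit Types A B D X Y Z : E.

Lemma confl0 A B D (i : hom A B) (p : hom B D) : confl i p -> p \co i = 0.
Proof. by case/confl_ker. Qed.

Lemma confl_lift A B D (i : hom A B) (p : hom B D) W (x : hom W B) :
  confl i p -> p \co x = 0 -> exists y, i \co y = x.
Proof. by move=> /confl_ker[_ k] /k[y [e _]]; exists y. Qed.

Lemma confl_ext A B D (i : hom A B) (p : hom B D) W (x : hom B W) :
  confl i p -> x \co i = 0 -> exists y, y \co p = x.
Proof. by move=> /confl_coker[_ k] /k[y [e _]]; exists y. Qed.

Lemma confl_mono A B D (i : hom A B) (p : hom B D) W (x y : hom W A) :
  confl i p -> i \co x = i \co y -> x = y.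
Proof. by move=> /confl_ker/kernel_mono; apply. Qed.

Lemma confl_epi A B D (i : hom A B) (p : hom B D) W (x y : hom D W) :
  confl i p -> x \co p = y \co p -> x = y.
Proof. by move=> /confl_coker/cokernel_epi; apply. Qed.

(** The axiom provides some pushout along which inflations are stable; as
    pushouts are unique up to isomorphism and have isomorphic cokernels, every
    pushout square will do, with the same cokernel object. *)
Lemma pushout_confl A B D A' B' (i : @hom E A B) (p : hom B D) (f : @hom E A A')
    (i' : @hom E A' B') (f' : @hom E B B') :
  confl i p -> is_pushout i f i' f' ->
  exists p' : hom B' D, confl i' p' /\ p' \co f' = p.
Proof.
move=> cip po; have [sq univ] := po.
have [|B1 [i1 [f1 [po1 [D1 [q1 c1]]]]]] := @adm_mono_pushout E A B A' i f.
  by exists D, p.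
have [sq1 univ1] := po1.
have [th [[th1 th2] _]] := univ1 _ f' i' sq.
have [th' [[th1' th2'] _]] := univ _ f1 i1 sq1.
have [|p' [[ep1 ep2] _]] := univ _ p (0 : hom A' D).
  by rewrite comp0m (confl0 cip).
have [|c ec] := @confl_ext _ _ _ _ _ _ (p' \co th) c1.
  by rewrite -compA th2 ep2.
have [|c' ec'] := @confl_ext _ _ _ _ _ _ (q1 \co f1) cip.
  by rewrite -compA sq1 compA (confl0 c1) comp0m.
exists p'; split=> //.
apply: (@confl_iso E _ _ _ _ _ _ i1 q1 i' p' (idm _) th c) => //.
- exact: is_iso_idm.
- exists th'; split.
  + by apply: (pushout_hom_ext po1); rewrite comp1m -compA ?th1 ?th2.
  + by apply: (pushout_hom_ext po); rewrite comp1m -compA ?th1' ?th2'.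
- exists c'; split.
  + apply: (confl_epi c1); rewrite -compA ec comp1m.
    apply: (pushout_hom_ext po1); rewrite -!compA.
    * by rewrite th1 ep1.
    * by rewrite th2 ep2 compm0 (confl0 c1).
  + by apply: (confl_epi cip); rewrite -compA ec' compA ec -compA th1 ep1 comp1m.
- by rewrite compm1.
Qed.

End Conflations.

Lemma pullback_confl (E : exactCat) (A B D D' B' : E) (i : hom A B) (p : @hom E B D)
    (f : @hom E D' D) (p' : @hom E B' D') (f' : @hom E B' B) :
  confl i p -> is_pullback p f p' f' ->
  exists i' : hom A B', confl i' p' /\ f' \co i' = i.
Proof.
move=> c [sq univ].
apply: (@pushout_confl (op_exact E) D B A D' B' p i f p' f' c).
by split.
Qed.

Section Deflations.
Variable E : exactCat.
Implicit Types A B D X Y Z : E.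

Lemma pushout_ex A B D A' (i : @hom E A B) (p : hom B D) (f : @hom E A A') :
  confl i p -> exists B' (i' : hom A' B') (f' : hom B B') (p' : hom B' D),
    [/\ is_pushout i f i' f', confl i' p' & p' \co f' = p].
Proof.
move=> cip; have [|B' [i' [f' [po _]]]] := @adm_mono_pushout E A B A' i f.
  by exists D, p.
by have [p' [c e]] := pushout_confl cip po; exists B', i', f', p'.
Qed.

Lemma confl_zob_l A : confl (0 : hom (zob : E) A) (idm A).
Proof.
have [X [i c]] := adm_epi_id A.
have i0 : i = 0 by rewrite -[i]comp1m (confl0 c).
apply: (@confl_iso E _ _ _ _ _ _ i (idm A) _ _ 0 (idm A) (idm A)) => //.
- exists 0; split; last by rewrite comp0m zobP.
  by apply: (confl_mono c); rewrite i0 !comp0m.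
- exact: is_iso_idm.
- exact: is_iso_idm.
- by rewrite comp0m i0 compm0.
Qed.

Lemma confl_zob_r A : confl (idm A) (0 : hom A (zob : E)).
Proof.
have [X [p c]] := adm_mono_id A.
have p0 : p = 0 by rewrite -[p]compm1 (confl0 c).
apply: (@confl_iso E _ _ _ _ _ _ (idm A) p _ _ (idm A) (idm A) 0) => //.
- exact: is_iso_idm.
- exact: is_iso_idm.
- exists 0; split; last by rewrite comp0m zobP.
  by apply: (confl_epi c); rewrite p0 !compm0.
- by rewrite comp0m comp0m.
Qed.

(** A direct sum is the pushout of two morphisms from zero. *)
Lemma confl_bip A B : confl (bin1 A B) (bpr2 A B).
Proof.
have [|p' [c e]] := @pushout_confl E _ _ _ _ _ (0 : hom zob B) (idm B)
  (0 : hom zob A) (bin1 A B) (bin2 A B) (confl_zob_l B).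
  split; first by rewrite !compm0.
  move=> W x y _; exists (copair y x); split.
    by rewrite copair_bin1 copair_bin2.
  by move=> z [<- <-]; apply: bip_cohom_ext; rewrite ?copair_bin1 ?copair_bin2.
suff <- : p' = bpr2 A B by [].
by apply: bip_cohom_ext; rewrite ?bpr2_in1 ?bpr2_in2 ?(confl0 c).
Qed.

Lemma confl_iso_mid A B B' D (i : hom A B) (p : hom B D) (b : hom B B') (b' : hom B' B) :
  b' \co b = idm B -> b \co b' = idm B' -> confl i p -> confl (b \co i) (p \co b').
Proof.
move=> e1 e2; apply: (@confl_iso E _ _ _ _ _ _ _ _ _ _ (idm A) b (idm D)).
- exact: is_iso_idm.
- by exists b'.
- exact: is_iso_idm.
- by rewrite compm1.
- by rewrite -compA e1 compm1 comp1m.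
Qed.

Lemma adm_epi_copair A B D (f : hom A D) (p : hom B D) :
  adm_epi p -> adm_epi (copair f p).
Proof.
(* copair f p is the composite of 1 (+) p with the split epimorphism (f, 1) *)
move=> [K [i c]].
have -> : copair f p = copair f (idm D) \co mpair (bpr1 A B) (p \co bpr2 A B).
  by rewrite copair_pair comp1m.
apply: adm_epi_comp.
- have [|i' [c' _]] := @pullback_confl E _ _ _ _ _ i p (bpr2 A D)
    (mpair (bpr1 A B) (p \co bpr2 A B)) (bpr2 A B) c.
  + split; first by rewrite bpr2_pair.
    move=> W x y e; exists (mpair (bpr1 A D \co y) x); split.
      split; first by rewrite bpr2_pair.
      apply: bip_hom_ext; rewrite compA.
        by rewrite bpr1_pair bpr1_pair.
      by rewrite bpr2_pair -compA bpr2_pair e.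
    move=> z [<- <-]; apply: bip_hom_ext.
      by rewrite bpr1_pair compA bpr1_pair.
    by rewrite bpr2_pair.
  + by exists K, i'.
- have c' := @confl_iso_mid _ _ _ _ _ _
    (mpair (bpr1 A D) (bpr2 A D - f \co bpr1 A D))
    (mpair (bpr1 A D) (copair f (idm D))) _ _ (confl_bip A D).
  rewrite bpr2_pair in c'; eexists; eexists; apply: c'.
  + apply: bip_hom_ext; rewrite compA ?bpr1_pair ?bpr2_pair compm1 ?bpr1_pair //.
    by rewrite copair_pair comp1m addrC subrK.
  + apply: bip_hom_ext; rewrite compA ?bpr1_pair ?bpr2_pair compm1 ?bpr1_pair //.
    by rewrite compBl -compA bpr1_pair bpr2_pair /copair comp1m addrAC subrr add0r.
Qed.

End Deflations.

Lemma adm_mono_pair (E : exactCat) (A B D : E) (f : hom D A) (i : hom D B) :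
  adm_mono i -> adm_mono (mpair f i).
Proof.
by move=> h; exact: (@adm_epi_copair (op_exact E) A B D f i h).
Qed.

Section SplitConflations.
Variable E : exactCat.
Implicit Types A B D X Y Z : E.

(** The inflation [i (+) 1] is the pushout of [i] along a coproduct injection. *)
Lemma adm_mono_bip A B X (i : hom A B) :
  adm_mono i -> adm_mono (copair (bin1 B X \co i) (bin2 B X)).
Proof.
move=> [D [p c]].
have [|p' [c' _]] := @pushout_confl E _ _ _ _ _ i p (bin1 A X)
  (copair (bin1 B X \co i) (bin2 B X)) (bin1 B X) c; last by exists D, p'.
split; first by rewrite copair_bin1.
move=> W x y e; exists (copair x (y \co bin2 A X)); split.
  split; first by rewrite copair_bin1.
  apply: bip_cohom_ext; rewrite -compA ?copair_bin1 ?copair_bin2 //.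
  by rewrite compA copair_bin1.
move=> z [<- <-]; apply: bip_cohom_ext; rewrite ?copair_bin1 ?copair_bin2 //.
by rewrite -compA copair_bin2.
Qed.

(** No idempotent completeness is assumed, so that a split monomorphism need not
    be an inflation; the section of a deflation is one. *)
Lemma split_confl X Y Z (v : hom X Y) (w : hom Y Z) (s : hom Z Y) :
  confl v w -> w \co s = idm Z ->
  exists r : hom Y X, [/\ r \co v = idm X, r \co s = 0, v \co r + s \co w = idm Y & confl s r].
Proof.
move=> c ws; have [|r er] := @confl_lift _ _ _ _ _ _ _ (idm Y - s \co w) c.
  by rewrite compBr compm1 compA ws comp1m subrr.
have rv : r \co v = idm X.
  by apply: (confl_mono c); rewrite compA er compBl -compA (confl0 c) compm0
    subr0 comp1m compm1.
have rs : r \co s = 0.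
  by apply: (confl_mono c); rewrite compA er compBl -compA ws comp1m compm1
    subrr compm0.
have sm : v \co r + s \co w = idm Y by rewrite er subrK.
exists r; split=> //.
have := @confl_iso_mid E _ _ _ _ _ _ (copair s v) (mpair w r) _ _ (confl_bip Z X).
rewrite copair_bin1 bpr2_pair; apply.
- apply: bip_hom_ext; rewrite compA ?bpr1_pair ?bpr2_pair compm1;
    apply: bip_cohom_ext; rewrite -compA ?copair_bin1 ?copair_bin2
    ?bpr1_in1 ?bpr1_in2 ?bpr2_in1 ?bpr2_in2 //.
  by rewrite (confl0 c).
- by rewrite copair_pair addrC.
Qed.

Lemma confl_retr_sect X Y Z (v : hom X Y) (w : hom Y Z) (r : hom Y X) :
  confl v w -> r \co v = idm X -> exists s : hom Z Y, w \co s = idm Z.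
Proof.
move=> c rv; have [|s es] := @confl_ext _ _ _ _ _ _ _ (idm Y - v \co r) c.
  by rewrite compBl comp1m -compA rv compm1 subrr.
exists s; apply: (confl_epi c); rewrite -compA es compBr compA (confl0 c).
by rewrite comp0m subr0 compm1 comp1m.
Qed.

End SplitConflations.

(** * Yoneda extensions and syzygies *)

Section YonedaExt.
Variables (E : exactCat) (S : syzygies E).
Implicit Types A B X Y Z Q : E.

Local Notation P := (pcov S).
Local Notation O := (syz S).
Local Notation inc := (syz_inc S).
Local Notation epi := (pcov_epi S).

(** The morphisms that vanish in the stable category. *)
Definition thru_proj A B (f : hom A B) :=
  exists Q (h : hom Q B) (k : hom A Q), projective Q /\ f = h \co k.

Lemma thru_proj0 A B : thru_proj (0 : hom A B).
Proof.
by exists zob, 0, 0; split; [exact: projective_zob | rewrite comp0m].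
Qed.

Lemma thru_proj_src Q B (f : hom Q B) : projective Q -> thru_proj f.
Proof. by move=> hQ; exists Q, f, (idm Q); rewrite compm1. Qed.

Lemma syz_lift_confl A X Y Z (v : hom X Y) (w : hom Y Z) (a : hom A Z) :
  confl v w -> exists (k : hom (O A) X) (m : hom (P A) Y),
    v \co k = m \co inc A /\ w \co m = a \co epi A.
Proof.
move=> c; have [|m em] := pcov_proj (s := S) (a \co epi A) (_ : adm_epi w).
  by exists X, v.
have [|k ek] := @confl_lift _ _ _ _ _ _ _ (m \co inc A) c; last by exists k, m.
by rewrite compA em -compA epi_inc compm0.
Qed.

(** The choice of the lift, and changing [a] by a morphism through a projective,
    alter the induced map on kernels only by a morphism extending to [P A]. *)
Lemma syz_lift_confl_uniq A X Y Z (v : hom X Y) (w : hom Y Z) (a a' : hom A Z)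
    (k k' : hom (O A) X) (m m' : hom (P A) Y) :
  confl v w -> thru_proj (a - a') ->
  v \co k = m \co inc A -> w \co m = a \co epi A ->
  v \co k' = m' \co inc A -> w \co m' = a' \co epi A ->
  exists t : hom (P A) X, k - k' = t \co inc A.
Proof.
move=> c [Q [h [g [hQ e]]]] ek em ek' em'.
have [|s es] := hQ _ _ w h; first by exists X, v.
have [|t et] := @confl_lift _ _ _ _ _ _ _ (m - m' - s \co g \co epi A) c.
  by rewrite !compBr em em' !compA es -e compBl subrr.
exists t; apply: (confl_mono c).
by rewrite compA et !compBl -[_ \co epi A \co _]compA epi_inc compm0 subr0
  compBr ek ek'.
Qed.

(** This expresses [Ext^1(A, B) = 0], as [Ext^1(A, B)] is the cokernel of the
    restriction from [hom (P A) B] to [hom (O A) B]. *)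
Definition ext1_0 A B :=
  forall f : hom (O A) B, exists t : hom (P A) B, f = t \co inc A.

(** [ext0 n A B] expresses [Ext^(n+1)(A, B) = 0], by dimension shift. *)
Definition ext0 n A B := ext1_0 (iter n O A) B.

Lemma ext0S n A B : ext0 n.+1 A B = ext0 n (O A) B.
Proof. by rewrite /ext0 iterSr. Qed.

(** [osyz n A] is [O^(n+1) A], with the recursion that makes the truncated
    projective resolution of [A] below a sequence in the sense of [yext]. *)
Fixpoint osyz n A : E := if n is m.+1 then osyz m (O A) else O A.

Fixpoint resolution n A : yext n A (osyz n A) :=
  match n return yext n A (osyz n A) with
  | 0 => Ses (syz_confl S A)
  | m.+1 => existT _ (O A) (Ses (syz_confl S A), resolution m (O A))
  end.

(** The morphisms from the last syzygy that extend to the last projective term of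
    the truncated resolution. *)
Fixpoint extends n A B : hom (osyz n A) B -> Prop :=
  match n return hom (osyz n A) B -> Prop with
  | 0 => fun f => exists t : hom (P A) B, f = t \co inc A
  | m.+1 => fun f => @extends m (O A) B f
  end.

Lemma ext0_extends n A B :
  ext0 n A B <-> forall f : hom (osyz n A) B, extends f.
Proof.
elim: n A => [|n IH] A; first by [].
by rewrite ext0S IH.
Qed.

Lemma yext_mor_comp n A A' A'' B B' B'' (a : hom A A') (a' : hom A' A'')
    (b : hom B B') (b' : hom B' B'') (x : yext n A B) (y : yext n A' B') (z : yext n A'' B'') :
  yext_mor a b x y -> yext_mor a' b' y z -> yext_mor (a' \co a) (b' \co b) x z.
Proof.
have ses_comp X X' X'' Z Z' Z'' (f : hom X X') (f' : hom X' X'') (g : hom Z Z')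
    (g' : hom Z' Z'') (s : ses X Z) (s' : ses X' Z') (s'' : ses X'' Z'') :
  ses_mor f g s s' -> ses_mor f' g' s' s'' -> ses_mor (f' \co f) (g' \co g) s s''.
  move=> [m [e1 e2]] [m' [e1' e2']]; exists (m' \co m).
  by rewrite !compA e1' -!compA e1 -e2 !compA e2'.
elim: n A A' A'' a a' x y z => [|n IH] A A' A'' a a' x y z /=; first exact: ses_comp.
move=> [k [h1 h2]] [k' [h1' h2']]; exists (k' \co k); split.
  exact: ses_comp h1'.
exact: IH h2'.
Qed.

(** The next two lemmas are the comparison theorem for projective resolutions:
    existence, and uniqueness up to homotopy. *)
Lemma resolution_lift n A A' B (a : hom A A') (x : yext n A' B) :
  exists f, yext_mor a f (resolution n A) x.
Proof.
elim: n A A' a x => [|n IH] A A' a x /=.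
  by have [k [m [e1 e2]]] := syz_lift_confl a (sesP x); exists k, m.
have [k [m [e1 e2]]] := syz_lift_confl a (sesP (projT2 x).1).
have [f hf] := IH _ _ k (projT2 x).2.
by exists f, k; split=> //; exists m.
Qed.

Lemma resolution_lift_uniq n A A' B (a a' : hom A A') f f' (x : yext n A' B) :
  thru_proj (a - a') -> yext_mor a f (resolution n A) x ->
  yext_mor a' f' (resolution n A) x -> extends (f - f').
Proof.
elim: n A A' a a' f f' x => [|n IH] A A' a a' f f' x haa /=.
  move=> [m [e1 e2]] [m' [e1' e2']].
  exact: syz_lift_confl_uniq (sesP x) haa e1 e2 e1' e2'.
move=> [k [[m [e1 e2]] hk]] [k' [[m' [e1' e2']] hk']].
have [t et] := syz_lift_confl_uniq (sesP (projT2 x).1) haa e1 e2 e1' e2'.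
apply: IH hk hk'; exists (P A), t, (inc A); split=> //; exact: pcov_proj.
Qed.

(** Only the class of the comparison map modulo [extends] matters, because the
    component of the morphism at the last projective term can absorb the
    difference. *)
Lemma resolution_lift_change n A A' B (a : hom A A') f f' (x : yext n A' B) :
  yext_mor a f (resolution n A) x -> extends (f - f') ->
  yext_mor a f' (resolution n A) x.
Proof.
elim: n A A' a f f' x => [|n IH] A A' a f f' x /=.
  move=> [m [e1 e2]] [t et]; exists (m - sinc x \co t); split.
    by rewrite compBl -e1 -compA -et compBr opprB addrC subrK.
  by rewrite compBr e2 compA (confl0 (sesP x)) comp0m subr0.
by move=> [k [h1 h2]] et; exists k; split=> //; exact: IH et.
Qed.

(** Only the short exact sequence that starts at [B] is pushed out, so the universal
    property of that pushout factors any morphism of sequences that begins with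
    [f]. *)
Lemma yext_pushout n A B B' (x : yext n A B) (f : hom B B') :
  exists y : yext n A B', yext_mor (idm A) f x y /\
    forall A' (a : hom A A') (z : yext n A' B'),
      yext_mor a f x z -> yext_mor a (idm B') y z.
Proof.
elim: n A x => [|n IH] A x /=.
  have [M [i' [f' [p' [po c e]]]]] := pushout_ex f (sesP x).
  exists (Ses c); split; first by exists f'; rewrite comp1m; case: po.
  move=> A' a z [m [e1 e2]].
  have [|u [[u1 u2] _]] := po.2 _ m (sinc z); first by rewrite -e1.
  exists u; rewrite compm1 u2; split=> //=.
  apply: (pushout_hom_ext po); rewrite -!compA; first by rewrite u1 e e2.
  by rewrite u2 (confl0 (sesP z)) (confl0 c) compm0.
have [y [h1 h2]] := IH _ (projT2 x).2.
exists (existT _ (projT1 x) ((projT2 x).1, y)); split.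
  exists (idm _); split=> //=.
  by exists (idm _); rewrite !comp1m !compm1.
by move=> A' a z [k [hk1 hk2]]; exists k; split=> //; exact: h2.
Qed.

(** An extension is determined up to equivalence by the class of the comparison
    map from the projective resolution, modulo the maps that extend to the last
    projective term; every class arises, by pushing out the resolution. *)
Lemma Ext_eq0_ext0 n A B : Ext_eq0 n.+1 A B <-> ext0 n A B.
Proof.
rewrite ext0_extends; split=> [h f|h x x'].
  have inv (x y : yext n A B) : yext_equiv x y -> forall g,
      yext_mor (idm A) g (resolution n A) x <-> yext_mor (idm A) g (resolution n A) y.
    elim=> [{}x {}y xy g|//|{}x {}y _ IH g|{}x {}y z _ IH1 _ IH2 g]; first last.
    - by rewrite IH1.
    - by rewrite IH.
    have fwd g' : yext_mor (idm A) g' (resolution n A) x ->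
        yext_mor (idm A) g' (resolution n A) y.
      by move=> hg; have := yext_mor_comp hg xy; rewrite !comp1m.
    split; first exact: fwd.
    have [g' hg'] := resolution_lift (idm A) x; move=> hg.
    apply: (resolution_lift_change hg').
    by apply: resolution_lift_uniq (fwd _ hg') hg; rewrite subrr; exact: thru_proj0.
  have [y [hy _]] := yext_pushout (resolution n A) f.
  have [z [hz _]] := yext_pushout (resolution n A) (0 : hom _ B).
  have hf := (inv _ _ (h y z) f).1 hy.
  have := resolution_lift_uniq _ hf hz; rewrite !subr0 subrr.
  by apply; exact: thru_proj0.
have [y [_ univ]] := yext_pushout (resolution n A) (0 : hom _ B).
have from_y w : yext_equiv y w.
  have [f hf] := resolution_lift (idm A) w.
  apply: rst_step; apply: univ; apply: resolution_lift_change hf _.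
  by rewrite subr0; exact: h.
by apply: rst_trans (from_y x'); exact/rst_sym/from_y.
Qed.

(** * Stable retracts *)

Definition stable_retract A B :=
  exists (f : hom A B) (g : hom B A), thru_proj (g \co f - idm A).

Definition stable_iso A B :=
  exists (f : hom A B) (g : hom B A), thru_proj (g \co f - idm A) /\ thru_proj (f \co g - idm B).

Lemma stable_iso_retract A B : stable_iso A B -> stable_retract A B.
Proof. by move=> [f [g [h _]]]; exists f, g. Qed.

Lemma stable_iso_sym A B : stable_iso A B -> stable_iso B A.
Proof. by move=> [f [g [h h']]]; exists g, f. Qed.

Lemma stable_retract_bip_l A B : stable_retract A (bip A B).
Proof.
exists (bin1 A B), (bpr1 A B); rewrite bpr1_in1 subrr; exact: thru_proj0.
Qed.

Lemma stable_iso_bip_projective A Q : projective Q -> stable_iso (bip A Q) A.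
Proof.
move=> hQ; exists (bpr1 A Q), (bin1 A Q); split; last first.
  by rewrite bpr1_in1 subrr; exact: thru_proj0.
exists Q, (- bin2 A Q), (bpr2 A Q); split=> //.
by rewrite -(bip_sum A Q) opprD addrA subrr add0r compNm.
Qed.

(** On syzygies, the defect of [l \co k] from the identity is a morphism that
    extends to the projective cover, which is stronger than factoring through some
    projective.  This is why [ext0] passes to stable retracts in its first
    variable. *)
Lemma stable_retract_syz A B : stable_retract A B ->
  exists (k : hom (O A) (O B)) (l : hom (O B) (O A)) (m : hom (P A) (P B))
    (t : hom (P A) (O A)),
    inc B \co k = m \co inc A /\ l \co k - idm (O A) = t \co inc A.
Proof.
move=> [f [g h]].
have [k [m [ek em]]] := syz_lift_confl f (syz_confl S B).
have [l [n [el en]]] := syz_lift_confl g (syz_confl S A).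
have [||||t et] := @syz_lift_confl_uniq _ _ _ _ _ _ _ _ (l \co k) (idm _)
  (n \co m) (idm _) (syz_confl S A) h.
- by rewrite compA el -!compA ek.
- by rewrite compA en -!compA em.
- by rewrite compm1 comp1m.
- by rewrite compm1 comp1m.
- by exists k, l, m, t.
Qed.

Lemma stable_retract_iter n A B :
  stable_retract A B -> stable_retract (iter n O A) (iter n O B).
Proof.
move=> h; elim: n => [|n IH] //=.
have [k [l [m [t [e1 e2]]]]] := stable_retract_syz IH.
exists k, l; rewrite e2; exists (P (iter n O A)), t, (inc _).
by split=> //; exact: pcov_proj.
Qed.

Lemma ext0_retract n A B C : stable_retract A B -> ext0 n B C -> ext0 n A C.
Proof.
move=> /(stable_retract_iter n); rewrite /ext0.
move: (iter n O A) (iter n O B) => {}A {}B h hB f.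
have [k [l [m [t [e1 e2]]]]] := stable_retract_syz h.
have [s es] := hB (f \co l).
exists (s \co m - f \co t).
rewrite compBl -!compA -e1 -e2 compBr compm1 !compA es.
by rewrite opprB addrC subrK.
Qed.

Lemma projective_retract Q A : projective Q -> forall (s : hom A Q) (r : hom Q A),
  r \co s = idm A -> projective A.
Proof.
move=> hQ s r e X Y p f hp; have [g eg] := hQ _ _ p (f \co r) hp.
by exists (g \co s); rewrite compA eg -compA e compm1.
Qed.

(** Syzygies of a projective are projective, and their covers split. *)
Lemma ext0_projective n Q C : projective Q -> ext0 n Q C.
Proof.
move=> hQ.
have hn : projective (iter n O Q).
  elim: n => //= n IH.
  have [s es] := IH _ _ _ (idm _) (pcov_adm S (iter n O Q)).
  have [r [er _ _ _]] := split_confl (syz_confl S _) es.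
  exact: projective_retract (pcov_proj (s := S) (A := iter n O Q)) _ _ er.
move=> f; have [s es] := hn _ _ _ (idm _) (pcov_adm S (iter n O Q)).
have [r [er _ _ _]] := split_confl (syz_confl S _) es.
by exists (f \co r); rewrite -compA er compm1.
Qed.

Lemma ext0_zob n A : ext0 n A zob.
Proof. by move=> f; exists 0; rewrite comp0m; exact: hom_to_zob. Qed.

Lemma ext0_bip n A B C : ext0 n A B -> ext0 n A C -> ext0 n A (bip B C).
Proof.
move=> hB hC f; have [t et] := hB (bpr1 B C \co f); have [s es] := hC (bpr2 B C \co f).
exists (mpair t s); apply: bip_hom_ext.
  by rewrite compA bpr1_pair.
by rewrite compA bpr2_pair.
Qed.

Definition ext_proj0 n A := forall Q, projective Q -> ext0 n A Q.

(** A morphism through a projective [Q] extends to the projective cover as soon as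
    its first factor, with target [Q], does. *)
Lemma ext0_thru_proj n A C : ext_proj0 n A ->
  (ext0 n A C <-> forall f : hom (iter n.+1 O A) C, thru_proj f).
Proof.
move=> hQ; split=> [h f|h f].
  have [t et] := h f; exists (P (iter n O A)), t, (inc _).
  by split=> //; exact: pcov_proj.
have [Q [g [k [hp e]]]] := h f; have [t et] := hQ _ hp k.
by exists (g \co t); rewrite e et compA.
Qed.

Lemma ext0_retract_tgt n A C D : ext_proj0 n A -> stable_retract C D ->
  ext0 n A D -> ext0 n A C.
Proof.
move=> hQ [f [g [Q [h [k [hp e]]]]]] hD x.
have [t et] := hD (f \co x); have [s es] := hQ _ hp (k \co x).
exists (g \co t - h \co s).
rewrite compBl -!compA -et -es !compA -e compBl comp1m.
by rewrite opprB addrC subrK.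
Qed.

(** * Exact sequences for Ext *)

(** Pulling a conflation back along the projective cover of its last term
    rotates it: the pullback splits as [bip X (P Z)]. *)
Lemma confl_rotate X Y Z (v : hom X Y) (w : hom Y Z) : confl v w ->
  exists (u : hom (O Z) X) (m : hom (P Z) Y),
    [/\ v \co u + m \co inc Z = 0, w \co m = epi Z &
        confl (mpair u (inc Z)) (copair v m)].
Proof.
move=> c; have [|m em] := pcov_proj (s := S) (epi Z) (_ : adm_epi w).
  by exists X, v.
have [|i' [c' ei]] := @pullback_confl E _ _ _ _ _ (inc Z) (epi Z) w
   (copair v m) (bpr2 X (P Z)) (syz_confl S Z).
  split.
    by rewrite /copair compDr !compA em (confl0 c) comp0m add0r.
  move=> W x y e; have [|z ez] := @confl_lift _ _ _ _ _ _ _ (y - m \co x) c.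
    by rewrite compBr compA em e subrr.
  exists (mpair z x); split.
    by rewrite bpr2_pair copair_pair ez subrK.
  move=> z' [ex ey]; apply: bip_hom_ext; last by rewrite bpr2_pair ex.
  rewrite bpr1_pair; apply: (confl_mono c); rewrite ez -ey -ex /copair compDl.
  by rewrite -!compA addrK.
have ei' : i' = mpair (bpr1 X (P Z) \co i') (inc Z).
  by apply: bip_hom_ext; rewrite ?bpr1_pair ?bpr2_pair.
exists (bpr1 X (P Z) \co i'), m; split=> //; last by rewrite -ei'.
by rewrite -copair_pair -ei' (confl0 c').
Qed.

(** The lemmas below are the parts of the two long exact sequences of a conflation
    [X -> Y -> Z] that are needed; [first], [mid] and [last] tell which of the
    three terms the conclusion is about, [src] and [tgt] in which variable. *)
Lemma ext1_0_lift A X Y Z (v : hom X Y) (w : hom Y Z) (f : hom A Z) :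
  confl v w -> ext1_0 A X -> exists s, w \co s = f.
Proof.
move=> c h; have [k [m [ek em]]] := syz_lift_confl f c.
have [t et] := h k.
have [|s es] := @confl_ext _ _ _ _ _ _ _ (m - v \co t) (syz_confl S A).
  by rewrite compBl -ek -compA -et subrr.
exists s; apply: (confl_epi (syz_confl S A)).
by rewrite -compA es compBr em compA (confl0 c) comp0m subr0.
Qed.

Lemma ext1_0_extend C X Y Z (v : hom X Y) (w : hom Y Z) (f : hom X C) :
  confl v w -> ext1_0 Z C -> exists s, s \co v = f.
Proof.
move=> c h; have [u [m [e1 e2 c']]] := confl_rotate c.
have [t et] := h (f \co u).
have [|s es] := @confl_ext _ _ _ _ _ _ _ (copair f (- t)) c'.
  by rewrite copair_pair compNm et subrr.
exists s.
by have := congr1 (fun x => x \co bin1 _ _) es; rewrite /= -compA !copair_bin1.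
Qed.

Lemma ext0_last_tgt n A X Y Z (v : hom X Y) (w : hom Y Z) :
  confl v w -> ext0 n.+1 A X -> ext0 n A Y -> ext0 n A Z.
Proof.
move=> c hX hY f; have [s es] := ext1_0_lift f c hX.
by have [t et] := hY s; exists (w \co t); rewrite -compA -et.
Qed.

Lemma ext1_0_first_tgt A X Y Z (v : hom X Y) (w : hom Y Z) :
  confl v w -> ext1_0 A Y -> (forall f : hom A Z, exists s, w \co s = f) ->
  ext1_0 A X.
Proof.
move=> c hY hZ f; have [t et] := hY (v \co f).
have [|r er] := @confl_ext _ _ _ _ _ _ _ (w \co t) (syz_confl S A).
  by rewrite -compA -et compA (confl0 c) comp0m.
have [s es] := hZ r.
have [|q eq] := @confl_lift _ _ _ _ _ _ _ (t - s \co epi A) c.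
  by rewrite compBr compA es er subrr.
exists q; apply: (confl_mono c).
by rewrite compA eq compBl -compA epi_inc compm0 subr0 et.
Qed.

Lemma ext0_first_tgt n A X Y Z (v : hom X Y) (w : hom Y Z) :
  confl v w -> ext0 n.+1 A Y -> ext0 n A Z -> ext0 n.+1 A X.
Proof.
move=> c hY hZ; apply: (ext1_0_first_tgt c hY) => f.
have [t et] := hZ f.
have [|s es] := pcov_proj (s := S) t (_ : adm_epi w); first by exists X, v.
by exists (s \co inc _); rewrite compA es.
Qed.

(** Three rotations turn a conflation into one on the syzygies, up to projective
    summands; this gives exactness in the first variable by induction on the
    degree. *)
Lemma ext0_mid_src n C X Y Z (v : hom X Y) (w : hom Y Z) :
  confl v w -> ext0 n X C -> ext0 n Z C -> ext0 n Y C.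
Proof.
elim: n X Y Z v w => [|n IH] X Y Z v w c hX hZ.
  have [u [m [e1 e2 c1]]] := confl_rotate c.
  have [u' [m' [e1' e2' c2]]] := confl_rotate c1.
  have hXP : ext0 0 (bip X (P Z)) C.
    apply: ext0_retract hX.
    exact/stable_iso_retract/stable_iso_bip_projective/pcov_proj.
  (* extend f from O Y to bip (O Z) (P Y), then its first component to P Z *)
  move=> f; have [s es] := ext1_0_extend f c2 hXP.
  have [t et] := hZ (s \co bin1 _ _).
  have e3 : inc Z \co u' = - (bpr2 _ _ \co m') \co inc Y.
    have := congr1 (fun x => bpr2 _ _ \co x) e1'.
    rewrite /= compDr !compA bpr2_pair compm0 => /eqP.
    by rewrite addr_eq0 compNm => /eqP.
  exists (s \co bin2 _ _ - t \co (bpr2 _ _ \co m')).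
  rewrite -es compDr !compA et -(compA t (inc Z)) e3 !compBl compNm compmN !compA.
  by rewrite addrC.
have [u [m [e1 e2 c1]]] := confl_rotate c.
have [u' [m' [e1' e2' c2]]] := confl_rotate c1.
have [u'' [m'' [e1'' e2'' c3]]] := confl_rotate c2.
rewrite ext0S in hX; rewrite ext0S in hZ.
rewrite ext0S; apply: ext0_retract (stable_retract_bip_l _ _) _; apply: IH c3 _ _.
- rewrite -ext0S; apply: ext0_retract.
    exact/stable_iso_retract/stable_iso_bip_projective/pcov_proj.
  by rewrite ext0S.
- apply: ext0_retract hZ.
  exact/stable_iso_retract/stable_iso_bip_projective/pcov_proj.
Qed.

Lemma ext0_first_src n C X Y Z (v : hom X Y) (w : hom Y Z) :
  confl v w -> ext0 n Y C -> ext0 n.+1 Z C -> ext0 n X C.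
Proof.
move=> c hY hZ; have [u [m [_ _ c1]]] := confl_rotate c.
apply: ext0_retract (stable_retract_bip_l _ _) _.
by apply: ext0_mid_src c1 _ hY; rewrite -ext0S.
Qed.

Lemma ext0_last_src n C X Y Z (v : hom X Y) (w : hom Y Z) :
  confl v w -> ext0 n X C -> ext0 n.+1 Y C -> ext0 n.+1 Z C.
Proof.
move=> c hX hY; have [u [m [_ _ c1]]] := confl_rotate c.
rewrite ext0S; apply: (ext0_first_src c1); last by [].
apply: ext0_retract hX.
exact/stable_iso_retract/stable_iso_bip_projective/pcov_proj.
Qed.

Lemma ext1_0_last_src C X Y Z (v : hom X Y) (w : hom Y Z) :
  confl v w -> ext1_0 Y C -> (forall f : hom X C, exists s, s \co v = f) ->
  ext1_0 Z C.
Proof.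
move=> c hY hX f; have [u [m [e1 e2 c1]]] := confl_rotate c.
have [s es] := ext1_0_extend f c1 hY.
have [g eg] := hX (s \co bin1 _ _).
exists (s \co bin2 _ _ - g \co m).
rewrite -es compDr !compA -eg compBl addrC -!compA; congr (_ + _).
by rewrite -compmN; congr (_ \co _); apply/eqP; rewrite -addr_eq0 e1.
Qed.

End YonedaExt.

(** * Angles as chains of triangles *)

Section Chains.
Variable T : ltriCat.
Implicit Types A B C K : T.

(** An angle composes the morphisms of arbitrary triangles with matching ends, so
    the existence of an angle depends only on the triples of objects that underlie
    triangles; hence the morphisms are forgotten.  In [chain C1 l A] the list [l]
    consists of the middle terms from left to right, starting next to the left end
    [A] and ending next to [C1]. *)
Definition is_triangle A B K :=
  exists (u : hom (Om K) A) (v : hom A B) (w : hom B K), tri u v w.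

Fixpoint chain C1 (l : seq T) A : Prop :=
  if l is B :: l' then exists K, is_triangle A B K /\ chain C1 l' K else A = C1.

Lemma inner_precomp n A' A K B (v : hom A' A) (w : hom A K) (s : string n K B) :
  @inner T n.+1 A' B (existT _ A (v, precomp w s)) = A :: inner s.
Proof. by case: n s. Qed.

Lemma angle_chain d C1 A (h : hom (OmN d C1) A) (s : string d A C1) :
  angle h s -> size (inner s) = d /\ chain C1 (inner s) A.
Proof.
elim=> {d C1 A h s} [C1 K B u v w t|d C1 K A B h s u v w _ [e ch] t].
  by split=> //=; exists C1; split=> //; exists u, v, w.
rewrite inner_precomp /= e; split=> //.
by exists K; split=> //; exists u, v, w.
Qed.

Lemma chain_angle C1 l B A : chain C1 (B :: l) A ->
  exists (h : hom (OmN (size l).+1 C1) A) (s : string (size l).+1 A C1),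
    angle h s /\ inner s = B :: l.
Proof.
elim: l B A => [|B' l IH] B A [K [[u [v [w t]]] ch]].
  move: ch => /= ch; subst K.
  by exists u, (existT _ B (v, w)); split=> //; exact: angle1.
have [h [s [a e]]] := IH _ _ ch.
exists (u \co Om1 h), (existT _ B (v, precomp w s)); split; first exact: angleS.
by rewrite inner_precomp e.
Qed.

(** In a resolving angle the resolved object is the middle term next to the right
    end; this splits off its triangle. *)
Lemma chain_rcons C1 l C A :
  chain C1 (rcons l C) A <-> exists K, is_triangle K C C1 /\ chain K l A.
Proof.
elim: l A => [|B l IH] A /=.
  by split=> [[K [t <-]]|[K [t ->]]]; [exists A | exists C1].
split=> [[K [t /IH[K' [t' ch]]]]|[K' [t' [K [t ch]]]]].
  by exists K'; split=> //; exists K.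
by exists K; split=> //; apply/IH; exists K'.
Qed.

Lemma coresolving_chain d X C : (0 < d)%N ->
  coresolving_angle d X C <->
  exists l, [/\ size l = d, chain zob l C & List.Forall X l].
Proof.
move=> hd; split=> [[h [s [/angle_chain[e ch] hX]]]|[l [e ch hX]]].
  by exists (inner s).
case: l e ch hX => [e|B l <- ch hX]; first by rewrite -e in hd.
have [h [s [a es]]] := chain_angle ch.
by exists h, s; split=> //; rewrite es.
Qed.

Lemma resolving_chain d X C : (0 < d)%N ->
  resolving_angle d X C <->
  exists A K l, [/\ size l = d.-1, chain K l A, is_triangle K C zob & List.Forall X (A :: l)].
Proof.
move=> hd; split.
  move=> [A [h [s [Xs [/angle_chain[e ch] es hX]]]]].
  case: Xs es hX => [|A' l] [eA]; first by move=> ei; rewrite -e ei in hd.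
  rewrite -{A'}eA => ei hX; move: ch; rewrite ei => /chain_rcons[K [t ch]].
  by exists A, K, l; split=> //; rewrite -e ei size_rcons.
move=> [A [K [l [e ch t hX]]]].
have ch' : chain zob (rcons l C) A by apply/chain_rcons; exists K.
have [B [l' el]] : exists B l', rcons l C = B :: l'.
  by case: (l) => [|B l'] /=; [exists C, [::] | exists B, (rcons l' C)].
rewrite el in ch'; have [h [s [a es]]] := chain_angle ch'.
have ed : (size l').+1 = d.
  by have := congr1 size el; rewrite size_rcons e /= prednK.
rewrite -ed; exists A, h, s, (A :: l); split=> //.
by rewrite es /= el.
Qed.

End Chains.

(** * The stable category *)

Section StableLink.
Variables (E : exactCat) (S : syzygies E).
Implicit Types A B X Y Z Q : E.

Local Notation P := (pcov S).
Local Notation O := (syz S).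
Local Notation inc := (syz_inc S).
Local Notation epi := (pcov_epi S).
Local Notation T := (stable_ltri S).

Lemma cl_eq_thru_proj A B (f g : hom A B) : cl f = cl g <-> thru_proj (f - g).
Proof. exact: cl_eq. Qed.

Lemma cl_eq0_thru_proj A B (f : hom A B) : cl f = 0 <-> thru_proj f.
Proof. by rewrite -cl_zero cl_eq_thru_proj subr0. Qed.

Lemma stable_isoP A B : (exists f : @hom T A B, is_iso f) <-> stable_iso A B.
Proof.
split.
  move=> [f [g []]]; rewrite -[f](@cl_repr E A B) -[g](@cl_repr E B A) /= !scomp_cl.
  by move=> /cl_eq h1 /cl_eq h2; exists (repr (f : shom A B)), (repr (g : shom B A)).
move=> [f [g [/cl_eq h1 /cl_eq h2]]].
by exists (cl f), (cl g); rewrite /= !scomp_cl; split.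
Qed.

(** With [confl_triangle], chains of triangles become chains of conflations up to
    stable isomorphism. *)
Lemma triangle_confl A B D : @is_triangle T A B D ->
  exists X Y Z (v : hom X Y) (w : hom Y Z),
    [/\ confl v w, stable_iso A X, stable_iso B Y & stable_iso D Z].
Proof.
move=> [h [f [g [E1 [E2 [E3 [v [w [u [m [a [b [c [cvw _ [ha hb hc] _]]]]]]]]]]]]]].
by exists E3, E2, E1, v, w; split=> //; apply/stable_isoP; [exists a|exists b|exists c].
Qed.

Lemma confl_triangle X Y Z (v : hom X Y) (w : hom Y Z) :
  confl v w -> @is_triangle T X Y Z.
Proof.
move=> c; have [k [m [e1 e2]]] := @syz_lift_confl E S _ _ _ _ v w (idm Z) c.
exists (cl k), (cl v), (cl w), Z, Y, X, v, w, k, m.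
exists (idm (X : T)), (idm (Y : T)), (idm (Z : T)); split=> //.
- by rewrite e2 comp1m.
- by split; exact: is_iso_idm.
- split; last first.
  + by rewrite compm1 comp1m.
  + by rewrite compm1 comp1m.
  + have -> : sOm1 S (idm (Z : T)) = idm (O Z : T) by exact: sOm1_id.
    by rewrite compm1 comp1m.
Qed.


(** Both halves of the bijection extend a morphism from [O B] into a projective to
    [P B]: for surjectivity, the composite of a morphism [O B -> O C] with the
    inclusion into [P C]; for injectivity, the first factor of a stably zero
    morphism. *)
Lemma ext_proj0_Om1_bij B C : ext_proj0 S 0 B ->
  bijective (fun f : @hom T B C => (Om1 f : @hom T (O B) (O C))).
Proof.
move=> hB.
have inj : injective (fun f : @hom T B C => (Om1 f : @hom T (O B) (O C))).
  suff ker (f : @hom T B C) : Om1 f = 0 -> f = 0.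
    move=> f g e; apply/eqP; rewrite -subr_eq0; apply/eqP/ker.
    by apply: (addIr (Om1 g)); rewrite -Om1_add subrK add0r.
  rewrite -[f](@cl_repr E B C); move: (repr (f : shom B C)) => {}f.
  have [k [l [ek el]]] := @syz_lift_confl E S _ _ _ _ _ _ f (syz_confl S C).
  have -> : @Om1 T B C (cl f) = cl k by apply: sOm1_cl; exists l.
  move=> /cl_eq0_thru_proj[Q [h [g [hQ e]]]]; apply/cl_eq0_thru_proj.
  have [t et] := hB Q hQ g.
  have [|r er] := @confl_ext _ _ _ _ _ _ _ (l - inc C \co h \co t) (syz_confl S B).
    by rewrite compBl -ek e et !compA subrr.
  exists (P C), (epi C), r; split; first exact: pcov_proj.
  apply: (confl_epi (syz_confl S B)).
  by rewrite -compA er compBr !compA epi_inc !comp0m subr0 el.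
have surj (k : @hom T (O B) (O C)) : exists f : @hom T B C, Om1 f = k.
  rewrite -[k](@cl_repr E (O B) (O C)); move: (repr (k : shom (O B) (O C))) => {}k.
  have [l el] := hB _ (pcov_proj (s := S) (A := C)) (inc C \co k).
  have [|f ef] := @confl_ext _ _ _ _ _ _ _ (epi C \co l) (syz_confl S B).
    by rewrite -compA -el compA epi_inc comp0m.
  by exists (cl f); apply: sOm1_cl; exists l.
exists (fun k => sval (cid (surj k))) => [f|k]; last exact: svalP (cid (surj k)).
exact/inj/(svalP (cid (surj (Om1 f)))).
Qed.

(** Push the syzygy sequence of [B] out along [g : O B -> Q].  The resulting
    conflation [Q -> Y -> B], with deflation [w], rotates to
    [O B -> bip Q (P B) -> Y], whose middle term is projective; this yields a
    stable section of [Omega w] and then, as [Omega] is bijective on morphisms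
    from [B], a stable section of [w].  The error term factors through a
    projective, so it lifts along [w] and can be corrected: the conflation splits,
    and [g] extends. *)
Lemma Om1_bij_ext_proj0 B :
  (forall C, bijective (fun f : @hom T B C => (Om1 f : @hom T (O B) (O C)))) ->
  ext_proj0 S 0 B.
Proof.
move=> bij Q hQ g.
have [Y [v [m [w [[sq _] c em]]]]] := pushout_ex g (syz_confl S B).
have [u [n [e1 e2 c1]]] := confl_rotate S c.
have hN : projective (bip Q (P B)) by apply: projective_bip => //; exact: pcov_proj.
have [j ej] := hN _ _ (epi Y) (copair v n) (pcov_adm S Y).
have [|phi ephi] := @confl_lift _ _ _ _ _ _ _ (j \co mpair u (inc B)) (syz_confl S Y).
  by rewrite compA ej (confl0 c1).
have [k [l [ek el]]] := @syz_lift_confl E S _ _ _ _ _ _ w (syz_confl S B).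
have hsec : cl (k \co phi) = cl (idm (O B)).
  have [|t et] := @confl_lift _ _ _ _ _ _ _ (l \co j - bpr2 Q (P B)) (syz_confl S B).
    rewrite compBr compA el -compA ej /copair compDr !compA (confl0 c) e2.
    by rewrite comp0m add0r subrr.
  apply/cl_eq_thru_proj; exists (bip Q (P B)), t, (mpair u (inc B)); split=> //.
  apply: (confl_mono (syz_confl S B)).
  rewrite compBr compA ek compm1 (compA (inc B) t) et compBl bpr2_pair.
  by rewrite -!compA ephi.
have [s es] : exists s : @hom T B Y, Om1 s = (cl phi : @hom T (O B) (O Y)).
  have [s' _ s'K] := bij Y; by exists (s' (cl phi)); exact: s'K.
have : (cl w : @hom T Y B) \co s = idm (B : T).
  apply: (bij_inj (bij B)); rewrite Om1_comp Om1_id es.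
  have -> : @Om1 T Y B (cl w) = cl k by apply: sOm1_cl; exists l.
  by rewrite /= scomp_cl.
rewrite -[s](@cl_repr E B Y) /= scomp_cl; move: (repr (s : shom B Y)) => {es}s.
move=> /cl_eq_thru_proj[R [h [r [hR e]]]].
have [|h' eh] := hR _ _ w h; first by exists Q, v.
have [|q [qv _ _ _]] := @split_confl _ _ _ _ _ _ (s - h' \co r) c.
  by rewrite compBr compA eh -e opprB addrC subrK.
by exists (q \co m); rewrite -compA sq compA qv comp1m.
Qed.

Lemma stable_iso_refl A : stable_iso A A.
Proof. by apply/stable_isoP; exists (idm (A : T)); exact: is_iso_idm. Qed.

Lemma stable_iso_trans A B C : stable_iso A B -> stable_iso B C -> stable_iso A C.
Proof.
move=> /stable_isoP[f [f' [e1 e2]]] /stable_isoP[g [g' [e3 e4]]].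
apply/stable_isoP; exists (g \co f), (f' \co g'); split.
  by rewrite -compA (compA g') e3 comp1m.
by rewrite -compA (compA f) e2 comp1m.
Qed.

Lemma stable_iso_projective Q Q' : projective Q -> projective Q' -> stable_iso Q Q'.
Proof.
by move=> hQ hQ'; exists 0, 0; split; exact: thru_proj_src.
Qed.

Lemma stable_zero_projective Z : stable_iso zob Z -> projective Z.
Proof.
move=> [f [g [_ [Q [h [k [hQ e]]]]]]]; apply: (projective_retract hQ (s := k) (r := - h)).
by rewrite compNm -e (hom_from_zob f) comp0m sub0r opprK.
Qed.

Lemma confl_stable_iso X Y Z (v : hom X Y) (w : hom Y Z) :
  confl v w -> projective Z -> stable_iso X Y.
Proof.
move=> c hZ; have [|s es] := hZ _ _ w (idm Z); first by exists X, v.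
have [r [rv _ e _]] := split_confl c es.
exists v, r; rewrite rv subrr -e; split; first exact: thru_proj0.
by exists Z, (- s), w; rewrite opprD addrA subrr add0r compNm.
Qed.

(** * From exact to stable cluster tilting *)

Section Tilting.
Variables (d : nat) (M : E -> Prop).

(** The two Ext-orthogonals of [M] in degrees [1, ..., d - 1]; these degrees are
    the [i.+1] below [d]. *)
Definition lperp A := forall X i, M X -> (i.+1 < d)%N -> ext0 S i A X.
Definition rperp A := forall X i, M X -> (i.+1 < d)%N -> ext0 S i X A.

Lemma lperp_Ext A : lperp A <->
  forall X i, M X -> (1 <= i <= d - 1)%N -> Ext_eq0 i A X.
Proof.
split=> [h X [|i] hX //= hi|h X i hX hi].
  by apply/Ext_eq0_ext0/h => //; rewrite subn1 ltn_predRL in hi.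
by apply/Ext_eq0_ext0/h; rewrite // subn1 ltn_predRL.
Qed.

Lemma rperp_Ext A : rperp A <->
  forall X i, M X -> (1 <= i <= d - 1)%N -> Ext_eq0 i X A.
Proof.
split=> [h X [|i] hX //= hi|h X i hX hi].
  by apply/Ext_eq0_ext0/h => //; rewrite subn1 ltn_predRL in hi.
by apply/Ext_eq0_ext0/h; rewrite // subn1 ltn_predRL.
Qed.

Section ExactToStable.
Hypothesis d_gt0 : (0 < d)%N.
Hypothesis MCT : exact_dCT d M.

Lemma exactCT_lperp A : M A <-> lperp A.
Proof. by case: MCT => _ h _ _; rewrite lperp_Ext. Qed.

Lemma exactCT_rperp A : M A <-> rperp A.
Proof. by case: MCT => _ _ h _; rewrite rperp_Ext. Qed.

Lemma exactCT_projective Q : projective Q -> M Q.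
Proof. by move=> hQ; apply/exactCT_lperp => X i _ _; exact: ext0_projective. Qed.

Lemma exactCT_ext0 X Y i : M X -> M Y -> (i.+1 < d)%N -> ext0 S i X Y.
Proof. by move=> /exactCT_lperp hX; exact: hX. Qed.

Lemma exactCT_ext_proj0 X i : M X -> (i.+1 < d)%N -> ext_proj0 S i X.
Proof. by move=> hX hi Q /exactCT_projective hQ; exact: exactCT_ext0. Qed.

(** Adding an inflation into an object of [M] turns a left approximation into one
    that is itself an inflation. *)
Lemma exactCT_left_approx A : exists X K (i : hom A X) (p : hom X K),
  [/\ M X, confl i p & forall Y, M Y -> forall g : hom A Y, exists h, h \co i = g].
Proof.
case: MCT => /(_ A)[_ [X1 [f [hX1 hf]]]] _ _ /(_ A)[[X2 [j [hX2 hj]]] _].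
have [K [p c]] := adm_mono_pair f hj.
exists (bip X1 X2), K, (mpair f j), p; split=> //.
  by apply/exactCT_rperp => X i hX hi; apply: ext0_bip; exact: exactCT_ext0.
move=> Y hY g; have [h eh] := hf Y hY g.
by exists (h \co bpr1 _ _); rewrite -compA bpr1_pair.
Qed.

Lemma exactCT_right_approx A : exists X K (i : hom K X) (p : hom X A),
  [/\ M X, confl i p & forall Y, M Y -> forall g : hom Y A, exists h, p \co h = g].
Proof.
case: MCT => /(_ A)[[X1 [f [hX1 hf]]] _] _ _ /(_ A)[_ [X2 [j [hX2 hj]]]].
have [K [i c]] := adm_epi_copair f hj.
exists (bip X1 X2), K, i, (copair f j); split=> //.
  by apply/exactCT_rperp => X n hX hi; apply: ext0_bip; exact: exactCT_ext0.
move=> Y hY g; have [h eh] := hf Y hY g.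
by exists (bin1 _ _ \co h); rewrite compA copair_bin1.
Qed.

(** Each left approximation lowers by one the number of degrees in which the
    extensions into [M] may fail to vanish. *)
Lemma exactCT_coresolution j A : (j < d)%N ->
  (forall i Y, M Y -> (i.+1 + j < d)%N -> ext0 S i A Y) ->
  exists l, [/\ size l = j.+1, @chain T zob l A & List.Forall M l].
Proof.
elim: j A => [|j IH] A hj hA.
  exists [:: A]; split=> //=.
    by exists zob; split=> //; exact: confl_triangle (confl_zob_r A).
  constructor; last by constructor.
  by apply/exactCT_lperp => X i hX hi; apply: hA => //; rewrite addn0.
have [X [K [v [w [hX c hv]]]]] := exactCT_left_approx A.
have [|i Y hY hi|l [e ch hl]] := IH K; first exact: ltnW.
  case: i hi => [|i] hi.
    apply: (ext1_0_last_src c); last exact: hv.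
    by apply: (@exactCT_ext0 _ _ 0) => //; apply: leq_ltn_trans hj; rewrite ltnS.
  apply: (ext0_last_src c); first by apply: hA; rewrite // addnS.
  by apply: exactCT_ext0 => //; apply: leq_ltn_trans hi; exact: leq_addr.
exists (X :: l); split; [by rewrite /= e| |by constructor].
by exists K; split=> //; exact: confl_triangle c.
Qed.

Lemma Forall_rcons (X : E -> Prop) l A : List.Forall X l -> X A -> List.Forall X (rcons l A).
Proof. by elim=> [|B {}l hB _ IH] hA /=; constructor=> //; exact: IH. Qed.

(** Dual to [exactCT_coresolution]: each right approximation lowers by one the
    number of degrees in which extensions from [M] may fail to vanish. *)
Lemma exactCT_resolution j C : (j < d)%N ->
  (forall i Y, M Y -> (i.+1 + j < d)%N -> ext0 S i Y C) ->
  exists A l, [/\ size l = j, @chain T C l A & List.Forall M (A :: l)].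
Proof.
elim: j C => [|j IH] C hj hC.
  exists C, [::]; split=> //; constructor; last by constructor.
  by apply/exactCT_rperp => X i hX hi; apply: hC => //; rewrite addn0.
have [X [K [v [w [hX c hv]]]]] := exactCT_right_approx C.
have [|i Y hY hi|A [l [e ch hl]]] := IH K; first exact: ltnW.
  case: i hi => [|i] hi.
    apply: (ext1_0_first_tgt c); last exact: hv.
    by apply: (@exactCT_ext0 _ _ 0) => //; apply: leq_ltn_trans hj; rewrite ltnS.
  apply: (ext0_first_tgt c); last by apply: hC; rewrite // addnS.
  by apply: exactCT_ext0 => //; apply: leq_ltn_trans hi; exact: leq_addr.
exists A, (rcons l X); split; first by rewrite size_rcons e.
  by apply/chain_rcons; exists K; split=> //; exact: confl_triangle c.
exact: (@Forall_rcons M (A :: l)).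
Qed.

Lemma exactCT_stableCT : @ltri_dCT T d M.
Proof.
have hd1 : (d.-1 < d)%N by rewrite prednK.
have nohyp i : (i.+1 + d.-1 < d)%N -> False.
  by rewrite addSn -addnS prednK // ltnNge leq_addl.
split.
- split; first by apply: exactCT_projective; exact: projective_zob.
  by move=> A B hA hB; apply/exactCT_rperp => X i hX hi; apply: ext0_bip; exact: exactCT_ext0.
- move=> A C C' hA /stable_isoP hiso; apply/exactCT_rperp => X i hX hi.
  have hQ := exactCT_ext_proj0 hX hi.
  apply: (ext0_retract_tgt hQ (stable_retract_bip_l C C')).
  by apply: (ext0_retract_tgt hQ (stable_iso_retract hiso)); exact: exactCT_ext0.
- move=> C; split.
    apply/coresolving_chain => //.
    have [//||l [e ch hl]] := @exactCT_coresolution d.-1 C; first by move=> i Y _ /nohyp.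
    by exists l; rewrite e prednK.
  apply/resolving_chain => //.
  have [//||A [l [e ch hl]]] := @exactCT_resolution d.-1 C; first by move=> i Y _ /nohyp.
  by exists A, C, l; split=> //; exact: confl_triangle (confl_zob_r C).
- move=> C A [|i] //= hA hi; apply: ext_proj0_Om1_bij.
  by apply: (exactCT_ext_proj0 hA); rewrite subn1 ltn_predRL in hi.
- move=> A A' [|i] //= hA hA' hi f.
  rewrite subn1 ltn_predRL in hi.
  rewrite -[f](@cl_repr E (iter i.+1 O A') A); apply/cl_eq0_thru_proj.
  exact: (ext0_thru_proj _ (exactCT_ext_proj0 hA' hi)).1 (exactCT_ext0 hA' hA hi) _.
Qed.

End ExactToStable.

(** * From stable to exact cluster tilting *)

Section StableToExact.
Hypothesis d_gt0 : (0 < d)%N.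
Hypothesis MCT : @ltri_dCT T d M.

Lemma stableCT_bip A B : M A -> M B -> M (bip A B).
Proof. by case: MCT => -[_ h] _ _ _ _; exact: h. Qed.

(** [B] is a summand of [bip B zob], which is stably isomorphic to [A]. *)
Lemma stableCT_iso A B : stable_iso A B -> M A -> M B.
Proof.
case: MCT => _ h _ _ _ hAB hA; apply: (h A B zob hA).
apply/stable_isoP; apply: stable_iso_trans (stable_iso_sym hAB).
by apply: stable_iso_bip_projective; exact: projective_zob.
Qed.

Lemma stableCT_projective Q : projective Q -> M Q.
Proof.
move=> hQ; apply: (@stableCT_iso zob); last by case: MCT => -[].
by apply: stable_iso_projective => //; exact: projective_zob.
Qed.

Lemma stableCT_ext_proj0 X i : M X -> (i.+1 < d)%N -> ext_proj0 S i X.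
Proof.
case: MCT => _ _ _ h _ hX hi.
apply: (@Om1_bij_ext_proj0 (iter i O X)) => C.
by apply: (h C X i.+1 hX); rewrite /= subn1 ltn_predRL.
Qed.

Lemma stableCT_ext0 X Y i : M X -> M Y -> (i.+1 < d)%N -> ext0 S i X Y.
Proof.
move=> hX hY hi; apply/(ext0_thru_proj _ (stableCT_ext_proj0 hX hi)) => f.
apply/cl_eq0_thru_proj; case: MCT => _ _ _ _ h.
by apply: (h Y X i.+1 hY hX); rewrite subn1 ltn_predRL.
Qed.

Lemma stableCT_split_kernel X Y Z (v : hom X Y) (w : hom Y Z) (s : hom Z Y) :
  confl v w -> w \co s = idm Z -> M Y -> M X.
Proof.
move=> c ws hY; have [r [rv rs e _]] := split_confl c ws.
case: MCT => _ h _ _ _.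
apply: (h Y X Z hY); apply/stable_isoP; exists (copair v s), (mpair r w).
rewrite copair_pair e subrr; split; last exact: thru_proj0.
have -> : mpair r w \co copair v s = idm _.
  apply: bip_hom_ext; rewrite compA ?bpr1_pair ?bpr2_pair compm1;
    apply: bip_cohom_ext; rewrite -compA ?copair_bin1 ?copair_bin2
    ?bpr1_in1 ?bpr1_in2 ?bpr2_in1 ?bpr2_in2 //.
  by rewrite (confl0 c).
by rewrite subrr; exact: thru_proj0.
Qed.

Lemma stableCT_split X Y Z (v : hom X Y) (w : hom Y Z) (s : hom Z Y) :
  confl v w -> w \co s = idm Z -> M Y -> M X /\ M Z.
Proof.
move=> c ws hY; have [r [rv _ _ c']] := split_confl c ws.
split; [exact: stableCT_split_kernel c ws hY | exact: stableCT_split_kernel c' rv hY].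
Qed.

Lemma stableCT_sub_lperp A : M A -> lperp A.
Proof. by move=> hA X i hX; exact: stableCT_ext0. Qed.

Lemma stableCT_sub_rperp A : M A -> rperp A.
Proof. by move=> hA X i hX; exact: stableCT_ext0. Qed.

Lemma stableCT_ext0_iso A X Y i : lperp A -> (i.+1 < d)%N -> stable_iso X Y ->
  ext0 S i A Y -> ext0 S i A X.
Proof.
move=> hA hi hXY; apply: ext0_retract_tgt (stable_iso_retract hXY).
by move=> Q /stableCT_projective hQ; exact: hA.
Qed.

(** Along a chain, from left to right, the vanishing of extensions from [lperp]
    loses its top degree at each triangle; degree one survives up to the left term
    of the last triangle. *)
Lemma stableCT_chain_last B l K C1 : (size (B :: l) < d)%N ->
  @chain T C1 (B :: l) K -> List.Forall M (B :: l) ->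
  (forall A, lperp A -> forall i, (i < size (B :: l))%N -> ext0 S i A K) ->
  exists X Y Z (v : hom X Y) (w : hom Y Z),
    [/\ confl v w, stable_iso C1 Z, M Y & forall A, lperp A -> ext0 S 0 A X].
Proof.
elim: l B K => [|B' l IH] B K hl [K' [/triangle_confl t ch]] hM hK.
  move: ch => /= <-; have [X [Y [Z [v [w [c hX hY hZ]]]]]] := t.
  exists X, Y, Z, v, w; split=> //.
    exact: stableCT_iso hY (List.Forall_inv hM).
  by move=> A hA; apply: (stableCT_ext0_iso hA hl (stable_iso_sym hX)); exact: hK.
apply: IH ch (List.Forall_inv_tail hM) _ => [|A hA i hi]; first exact: ltnW.
have [X [Y [Z [v [w [c hX hY hZ]]]]]] := t.
have hi2 : (i.+2 < d)%N by apply: leq_ltn_trans hl; rewrite ltnS.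
apply: (stableCT_ext0_iso hA (ltnW hi2) hZ); apply: (ext0_last_tgt c).
  by apply: (stableCT_ext0_iso hA hi2 (stable_iso_sym hX)); apply: hK.
apply: hA (ltnW hi2); exact: stableCT_iso hY (List.Forall_inv hM).
Qed.

(** The conflation below is the last triangle of a resolving chain of [C]; if
    [d = 1] there is none, but then [C] itself lies in [M] and the trivial conflation
    [0 -> C -> C] serves. *)
Lemma stableCT_resolving_confl C :
  exists X Y Z (v : hom X Y) (w : hom Y Z),
    [/\ confl v w, stable_iso C Z, M Y & forall A, lperp A -> ext0 S 0 A X].
Proof.
have [A [K [l [e ch t hM]]]] : exists A K l,
    [/\ size l = d.-1, @chain T K l A, @is_triangle T K C zob & List.Forall M (A :: l)].
  by case: MCT => _ _ /(_ C)[_ /(resolving_chain _ _ d_gt0)].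
have hA := List.Forall_inv hM; have hl := List.Forall_inv_tail hM.
have hKC : stable_iso K C.
  have [X [Y [Z [v [w [c hX hY hZ]]]]]] := triangle_confl t.
  apply: stable_iso_trans hX (stable_iso_trans _ (stable_iso_sym hY)).
  exact: confl_stable_iso c (stable_zero_projective hZ).
case: l e ch hl {hM} => [|B l] e ch hl.
  exists zob, C, C, 0, (idm C); split; [exact: confl_zob_l|exact: stable_iso_refl| |].
    by apply: stableCT_iso hKC _; rewrite -(ch : A = K).
  by move=> A' _; exact: ext0_zob.
have hs : (size (B :: l) < d)%N by rewrite e prednK.
have [|X [Y [Z [v [w [c hZ hY hX]]]]]] := stableCT_chain_last hs ch hl.
  by move=> A' hA' i hi; apply: hA' => //; exact: leq_ltn_trans hs.
exists X, Y, Z, v, w; split=> //.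
exact: stable_iso_trans (stable_iso_sym hKC) hZ.
Qed.

(** Reading a coresolving chain from its right end zero, where all extensions
    vanish, each triangle costs the top degree. *)
Lemma stableCT_chain_first l K A i : @chain T zob l K -> List.Forall M l ->
  rperp A -> (i + size l < d)%N -> ext0 S i K A.
Proof.
elim: l K i => [|B l IH] K i.
  by move=> /= -> _ _ _; apply: ext0_projective; exact: projective_zob.
move=> [K' [/triangle_confl[X [Y [Z [v [w [c hX hY hZ]]]]]] ch]] hM hA hi.
apply: ext0_retract (stable_iso_retract hX) _; apply: (ext0_first_src c).
  apply: hA; first exact: stableCT_iso hY (List.Forall_inv hM).
  by apply: leq_ltn_trans hi; rewrite /= addnS ltnS leq_addr.
apply: ext0_retract (stable_iso_retract (stable_iso_sym hZ)) _.
by apply: IH ch (List.Forall_inv_tail hM) hA _; rewrite addSnnS.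
Qed.

Lemma stableCT_coresolving_confl C :
  exists X Y Z (v : hom X Y) (w : hom Y Z),
    [/\ confl v w, stable_iso C X, M Y & forall A, rperp A -> ext0 S 0 Z A].
Proof.
have [l [e ch hM]] : exists l, [/\ size l = d, @chain T zob l C & List.Forall M l].
  by case: MCT => _ _ /(_ C)[/(coresolving_chain _ _ d_gt0)].
case: l e ch hM => [e|B l e]; first by move: d_gt0; rewrite -e.
move=> [K' [/triangle_confl[X [Y [Z [v [w [c hX hY hZ]]]]]] ch]] hM.
exists X, Y, Z, v, w; split=> //.
  exact: stableCT_iso hY (List.Forall_inv hM).
move=> A hA; apply: ext0_retract (stable_iso_retract (stable_iso_sym hZ)) _.
by apply: (stableCT_chain_first ch (List.Forall_inv_tail hM) hA); rewrite -e.
Qed.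

(** The conflation of [stableCT_resolving_confl] splits when [C] is in [lperp]. *)
Lemma stableCT_lperp_sub A : lperp A -> M A.
Proof.
move=> hA; have [X [Y [Z [v [w [c hZ hY hX]]]]]] := stableCT_resolving_confl A.
have hZl : lperp Z.
  move=> B i hB hi.
  exact: ext0_retract (stable_iso_retract (stable_iso_sym hZ)) (hA _ _ hB hi).
have [s es] := ext1_0_lift (idm Z) c (hX _ hZl).
have [_ hMZ] := stableCT_split c es hY.
exact: stableCT_iso (stable_iso_sym hZ) hMZ.
Qed.

Lemma stableCT_rperp_sub A : rperp A -> M A.
Proof.
move=> hA; have [X [Y [Z [v [w [c hX hY hZ]]]]]] := stableCT_coresolving_confl A.
have hXr : rperp X.
  move=> B i hB hi.
  apply: (stableCT_ext0_iso (stableCT_sub_lperp hB) hi (stable_iso_sym hX)); exact: hA.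
have [r er] := ext1_0_extend (idm X) c (hZ _ hXr).
have [s es] := confl_retr_sect c er.
have [hMX _] := stableCT_split c es hY.
exact: stableCT_iso (stable_iso_sym hX) hMX.
Qed.

(** [A] is only stably isomorphic to the first term [X] of the coresolving
    conflation.  Correcting the comparison [A -> X] by a component into [P A] makes
    it the section of the deflation [copair g (epi A)], hence an inflation. *)
Lemma stableCT_left_approx A : exists X (i : hom A X),
  [/\ M X, adm_mono i & forall Y, M Y -> forall g : hom A Y, exists h, h \co i = g].
Proof.
have [X [Y [Z [v [w [c [f [g [[Q [h [k [hQ e]]]] _]]] hY hZ]]]]]] := stableCT_coresolving_confl A.
have [h' eh] := hQ _ _ _ h (pcov_adm S A).
have [K [i ci]] := adm_epi_copair g (pcov_adm S A).
have [|r [_ _ _ cr]] := @split_confl _ _ _ _ _ _ (mpair f (- (h' \co k))) ci.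
  by rewrite copair_pair compmN compA eh -e opprB addrC subrK.
exists (bip Y (P A)), (copair (bin1 _ _ \co v) (bin2 _ _) \co mpair f (- (h' \co k))).
split.
- by apply: stableCT_bip => //; apply/stableCT_projective/pcov_proj.
- apply: adm_mono_comp; first by exists K, r.
  by apply: adm_mono_bip; exists Z, w.
- move=> B hB a; have [b eb] := ext1_0_extend (a \co g) c (hZ _ (stableCT_sub_rperp hB)).
  exists (copair b (a \co epi A)).
  rewrite copair_pair compDr -!compA (compA (copair _ _)) copair_bin1.
  rewrite (compA (copair _ _)) copair_bin2 compA eb compmN -!compA (compA (epi A)) eh.
  by rewrite -e -compBr opprB addrC subrK compm1.
Qed.

Lemma stableCT_right_approx A : exists X (p : hom X A),
  M X /\ forall Y, M Y -> forall g : hom Y A, exists h, p \co h = g.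
Proof.
have [X [Y [Z [v [w [c [f [g [[Q [h [k [hQ e]]]] _]]] hY hX]]]]]] := stableCT_resolving_confl A.
have [h' eh] := hQ _ _ _ h (pcov_adm S A).
exists (bip Y (P A)), (copair (g \co w) (epi A)); split.
  by apply: stableCT_bip => //; apply/stableCT_projective/pcov_proj.
move=> B hB a; have [b eb] := ext1_0_lift (f \co a) c (hX _ (stableCT_sub_lperp hB)).
exists (mpair b (- (h' \co k \co a))).
rewrite copair_pair -compA eb compmN !compA eh -e compBl comp1m opprB.
by rewrite addrC subrK.
Qed.

Lemma stableCT_exactCT : exact_dCT d M.
Proof.
split.
- move=> A; split; last first.
    by have [X [i [hX _ h]]] := stableCT_left_approx A; exists X, i.
  by have [X [p [hX h]]] := stableCT_right_approx A; exists X, p.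
- move=> A; rewrite -lperp_Ext; split; [exact: stableCT_sub_lperp|exact: stableCT_lperp_sub].
- move=> A; rewrite -rperp_Ext; split; [exact: stableCT_sub_rperp|exact: stableCT_rperp_sub].
- move=> A; split.
    by have [X [i [hX hi _]]] := stableCT_left_approx A; exists X, i.
  exists (P A), (epi A); split; last exact: pcov_adm.
  exact/stableCT_projective/pcov_proj.
Qed.

End StableToExact.

Lemma cluster_tilting_iff : (0 < d)%N -> exact_dCT d M <-> @ltri_dCT T d M.
Proof.
by move=> hd; split; [exact: exactCT_stableCT | exact: stableCT_exactCT].
Qed.

Lemma dZ_cluster_tilting_iff : (0 < d)%N -> exact_dZCT d M <-> @ltri_dZCT T d M.
Proof.
move=> hd; split=> -[hM hdZ].
  split; first by apply/cluster_tilting_iff.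
  move=> A hA; apply/(exactCT_lperp hM) => X i hX hi.
  suff : ext0 S (i + d) A X by rewrite /ext0 iterD.
  apply/(Ext_eq0_ext0 S); apply: hdZ hA hX.
  by rewrite -addSn dvdn_addl // gtnNdvd.
have hM' := (cluster_tilting_iff hd).2 hM; split=> // -[|n] hn X Y hX hY.
  by rewrite dvdn0 in hn.
apply/(Ext_eq0_ext0 S).
have hit q : M (iter (q * d) O X).
  by elim: q => [|q IH] //=; rewrite mulSn iterD; exact: hdZ.
have r_gt0 : (0 < n.+1 %% d)%N by rewrite lt0n.
have en : n = ((n.+1 %% d).-1 + n.+1 %/ d * d)%N.
  by apply: succn_inj; rewrite -addSn prednK // addnC -divn_eq.
rewrite en; suff : ext0 S (n.+1 %% d).-1 (iter (n.+1 %/ d * d) O X) Y.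
  by rewrite /ext0 -iterD.
by apply: stableCT_ext0 hY _ => //; rewrite prednK // ltn_mod.
Qed.

End Tilting.

End StableLink.

Theorem theorem6p1 (d : nat) (E : exactCat) (M : E -> Prop) (S : syzygies E) :
  (0 < d)%N ->
  enough_projectives E ->
  (exact_dCT d M <-> @ltri_dCT (stable_ltri S) d (stable_sub M)) /\
  (exact_dZCT d M <-> @ltri_dZCT (stable_ltri S) d (stable_sub M)).
Proof.
move=> hd _; split; first exact: cluster_tilting_iff.
exact: dZ_cluster_tilting_iff.
Qed.
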